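(* Let $X\ge0$ be a heavy-tailed random variable, let $(X_i)_{i\ge1}$ be IID with the law of $X$, let $N$ be a heavy-tailed random variable with values in $\{1,2,3,\dots\}$ independent of $(X_i)$, and put $S_N=\sum_{k=1}^N X_k$. Assume one of the following: (i) there is a natural scale $h_X$ of $X$ with $\liminf_{x\to\infty}h_X(x)/\sqrt{x}\in(0,\infty]$, and there are a natural scale $h_N$ of $N$ and a constant $c_1>E(X)$ with $\liminf_{x\to\infty}h_N(c_1x)/h_X(x)\in(0,\infty]$; (ii) there is a natural scale $h_N$ of $N$ with $\liminf_{x\to\infty}h_N(E(X)x)/\sqrt{x}\in(0,\infty]$, and there is a natural scale $h_X$ of $X$ with $\liminf_{x\to\infty}h_X(x)/h_N(E(X)x)\in(0,\infty]$. Then $S_N$ is determined by its moments.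
   Context: $R_Y(x):=-\log P(Y>x)$. $Y$ is heavy-tailed if $E(e^{sY})=\infty$ for all $s>0$. A natural scale of a heavy-tailed $Y$ is a concave $h:[0,\infty)\to[0,\infty)$ with $h(0)=0$, $h(x)\to\infty$, and $\liminf_{x\to\infty}R_Y(x)/h(x)=1$. A non-negative random variable with all moments finite is determined by its moments if any non-negative random variable with the same moment sequence has the same law. *)

(* Defs.v *)
From HB Require Import structures.
From mathcomp Require Import all_boot all_order all_algebra.
From mathcomp Require Import all_classical all_reals all_analysis.
Set Implicit Arguments. Unset Strict Implicit. Unset Printing Implicit Defensive.
Import Order.TTheory GRing.Theory Num.Theory.
Import numFieldNormedType.Exports.
Local Open Scope classical_set_scope.
Local Open Scope ring_scope.

Section Defs.
Context {d : measure_display} {T : measurableType d} {R : realType}.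
Variable P : probability T R.

Definition tailP (Y : T -> R) (x : R) : \bar R := P [set w | x < Y w].

Definition Rfun (Y : T -> R) (x : R) : \bar R :=
  if tailP Y x == 0%E then +oo%E else (- ln (fine (tailP Y x)))%:E.

Definition heavy_tailed (Y : T -> R) : Prop :=
  forall s : R, 0 < s -> ('E_P[(fun w => (expR (s * Y w))%R)] = +oo)%E.

Definition liminf_pinfty (f : R -> \bar R) : \bar R :=
  limf_einf f (pinfty_nbhs R).

Definition concave_nonneg (h : R -> R) : Prop :=
  forall x y t : R, 0 <= x -> 0 <= y -> 0 <= t <= 1 ->
    t * h x + (1 - t) * h y <= h (t * x + (1 - t) * y).

Definition natural_scale (Y : T -> R) (h : R -> R) : Prop :=
  concave_nonneg h /\ (forall x, 0 <= x -> 0 <= h x) /\ h 0 = 0 /\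
  (h x @[x --> +oo] --> +oo) /\
  liminf_pinfty (fun x => (Rfun Y x * ((h x)^-1)%:E)%E) = 1%E.

End Defs.

Definition determined_by_moments {d : measure_display} {T : measurableType d}
  {R : realType} (P : probability T R) (S : T -> R) : Prop :=
  measurable_fun setT S /\
  P [set w | S w < 0] = 0%E /\
  (forall k : nat, ('E_P[(fun w => (S w ^+ k)%R)] < +oo)%E) /\
  forall (d' : measure_display) (T' : measurableType d')
         (Q : probability T' R) (Y : T' -> R),
    measurable_fun setT Y -> Q [set w | Y w < 0] = 0%E ->
    (forall k : nat, ('E_Q[(fun w => (Y w ^+ k)%R)] = 'E_P[(fun w => (S w ^+ k)%R)])%E) ->
    forall A : set R, measurable A -> Q (Y @^-1` A) = P (S @^-1` A).

Definition indep_family {d : measure_display} {T : measurableType d}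
  {R : realType} (P : probability T R) (X : nat -> T -> R) (N : T -> nat) : Prop :=
  forall (n : nat) (A : nat -> set R) (B : set nat),
    (forall i, measurable (A i)) ->
    P [set w | (forall i, (i < n)%N -> A i (X i w)) /\ B (N w)] =
    ((\prod_(i < n) P (X i @^-1` A i)) * P (N @^-1` B))%E.

Definition random_sum {T : Type} {R : realType} (X : nat -> T -> R) (N : T -> nat)
  : T -> R := fun w => \sum_(k < N w) X k w.

(* Main.v *)
Require Import Defs.
From HB Require Import structures.
From mathcomp Require Import all_boot all_order all_algebra.
From mathcomp Require Import all_classical all_reals all_analysis measurable_realfun.
From mathcomp Require Import ring lra.
Import Order.TTheory GRing.Theory Num.Theory.
Import numFieldNormedType.Exports.
Local Open Scope classical_set_scope.
Local Open Scope ring_scope.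

(**
  Each alternative gives P(X > x), P(N > x) <= exp (- c sqrt x) for large x, hence
  E X^j and E N^j are at most C b^j (2j)!.  For S_n = X_1 + ... + X_n, induction
  on n with the binomial formula yields, for any z > 0 with k z <= 1,
  E S_n^k <= k! (a / z)^k (1 + 3 z)^n, and z = min (1 / k, k / n) turns this into
  E S_n^k <= D^k (k^(2k) + n^k).  Integrating over N gives E S_N^k <= C D^k (2k)!.

  This growth determines a law on [0, +oo[.  If two measures have these same
  moments, say that g is a multiplier when multiplication by g preserves the
  bounded f for which the two integrals of f x^k agree for every k.  Multipliers
  form an algebra closed under bounded pointwise limits, hence under exp.  The
  power series of cos makes cos (t sqrt x) a multiplier for small t; letting t
  tend to 0, so is exp (- x) = lim exp (- 2 (1 - cos (t sqrt x)) / t^2); and with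
  c = exp (- x) - exp (- b) so is 1_(x < b) = lim exp (- n exp (- n c)).
*)

(** * Determinacy under moment growth *)

Section weighted_integrals.
Context {R : realType} (m : {measure set R -> \bar R}).
Local Notation D := (`[0%R, +oo[%classic : set R).
Hypothesis mom_fin : forall k, (\int[m]_(x in D) (x ^+ k)%:E < +oo)%E.

Let mD : measurable D. Proof. exact: measurable_itv. Qed.

Let D_ge0 (x : R) : D x -> 0 <= x.
Proof. by rewrite /= in_itv/= andbT. Qed.

Lemma integrable_power k : m.-integrable D (fun x => (x ^+ k)%:E).
Proof.
apply/integrableP; split.
  by apply/measurable_EFinP; exact: exprn_measurable.
under eq_integral => x /set_mem /D_ge0 x0.
  rewrite gee0_abs ?lee_fin ?exprn_ge0//; over.
exact: mom_fin.
Qed.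

Lemma integrable_mul_power (f : R -> R) (C : R) k : measurable_fun setT f ->
  (forall x, `|f x| <= C) -> m.-integrable D (fun x => (f x * x ^+ k)%:E).
Proof.
move=> mf fC.
apply: (@le_integrable _ _ _ _ _ mD _ (fun x => C%:E * (x ^+ k)%:E)%E).
- apply/measurable_EFinP/measurable_funM; last exact: exprn_measurable.
  exact: measurable_funTS.
- move=> x _ /=; rewrite lee_fin !normrM ler_wpM2r//.
  exact: le_trans (fC x) (ler_norm _).
- exact: integrableZl (integrable_power k).
Qed.

(** Dominated convergence with majorant [C * x ^+ k]. Convergence is asked for on [x >= 0] only,
    where the integral lives. *)
Lemma cvg_bounded_mul_power (f_ : nat -> R -> R) (f : R -> R) (C : R) k :
  (forall n, measurable_fun setT (f_ n)) -> measurable_fun setT f ->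
  (forall n x, `|f_ n x| <= C) ->
  (forall x, 0 <= x -> f_ n x @[n --> \oo] --> f x) ->
  (\int[m]_(x in D) (f_ n x * x ^+ k)%:E @[n --> \oo] -->
   \int[m]_(x in D) (f x * x ^+ k)%:E)%E.
Proof.
move=> mf_ mf f_C f_f.
have := @dominated_convergence _ _ _ m D mD (fun n x => (f_ n x * x ^+ k)%:E)
  (fun x => (f x * x ^+ k)%:E) (fun x => C%:E * (x ^+ k)%:E)%E.
case=> //.
- move=> n; apply/measurable_EFinP/measurable_funM; last exact: exprn_measurable.
  exact: measurable_funTS.
- apply/measurable_EFinP/measurable_funM; last exact: exprn_measurable.
  exact: measurable_funTS.
- apply: aeW => x /D_ge0 x0.
  by apply: cvg_EFin; [exact: nearW|apply: cvgMr_tmp; exact: f_f].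
- exact: integrableZl (integrable_power k).
- apply: aeW => x n /D_ge0 x0.
  by rewrite lee_fin normrM (ger0_norm (exprn_ge0 _ x0)) ler_wpM2r ?exprn_ge0.
Qed.

End weighted_integrals.

Lemma measurable_cos_sqrt {R : realType} (t : R) :
  measurable_fun setT (fun x : R => cos (t * Num.sqrt x)).
Proof.
apply: continuous_measurable_fun => x.
apply: continuous_comp; last exact: continuous_cos.
by apply: cvgMl_tmp; exact: sqrt_continuous.
Qed.

(** The binomial coefficient ['C(a + b, a)] is one term in the expansion of [(1 + 1) ^ (a + b)]. *)
Lemma fact_add_le (a b : nat) :
  ((a + b)`! <= 2 ^ (a + b) * (a`! * b`!))%N.
Proof.
have <- : ('C(a + b, a) * (a`! * b`!) = (a + b)`!)%N.
  by rewrite -[in RHS](@bin_fact (a + b) a) ?leq_addr// addKn.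
rewrite leq_mul2r; apply/orP; right.
rewrite -[2%N]/(1 + 1)%N expnDn.
under eq_bigr do rewrite !exp1n !muln1.
have h : (a < (a + b).+1)%N by rewrite ltnS leq_addr.
by rewrite (bigD1 (Ordinal h))//= leq_addr.
Qed.

(** The sequence is the difference quotient at 0, with increments [h n], of [y => sin (y * u)],
    whose derivative there is [u]. *)
Lemma cvg_sinMr_div {R : realType} (u : R) (h : R^nat) :
  (forall n, h n != 0) -> h n @[n --> \oo] --> 0 ->
  sin (h n * u) / h n @[n --> \oo] --> u.
Proof.
move=> hn0 h0.
have : is_derive (0 : R) 1 (fun y : R => sin (y * u)) u.
  have du : is_derive (0 : R) 1 (fun y : R => y * u) u.
    rewrite (_ : (fun y : R => y * u) = (u \*: id)); last first.
      by apply/funext => y; rewrite /= mulrC.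
    by apply: is_derive_eq; rewrite /GRing.scale/= mulr1.
  have dsin := @is_derive1_comp R sin (fun y => y * u) 0 _ _ (is_derive_sin _) du.
  by apply: (@is_derive_eq _ _ _ _ _ _ _ _ dsin); rewrite mul0r cos0 mul1r.
case=> dv dE; have : (fun y : R => y^-1 *: (((fun y : R => sin (y * u)) \o shift 0)
  (y *: 1) - sin (0 * u))) y @[y --> 0^'] --> u by rewrite -[X in _ --> X]dE.
move=> /cvgr_dnbhsP /(_ h (conj hn0 h0)).
apply: cvg_trans; apply: near_eq_cvg; apply: nearW => n /=.
by rewrite mul0r sin0 subr0 addr0 /GRing.scale/= mulr1 mulrC.
Qed.

(** * Term by term integration of the cosine series *)

Section cosine_series.
Context {R : realType} (m : {measure set R -> \bar R}).
Local Notation D := (`[0%R, +oo[%classic : set R).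
Variables (C B t : R).
Hypotheses (C0 : 0 <= C) (B0 : 0 < B) (tB : 4 * t ^+ 2 * B < 1).
Hypothesis mom : forall k,
  (\int[m]_(x in D) (x ^+ k)%:E <= (C * B ^+ k * (k.*2)`!%:R)%:E)%E.

Let mD : measurable D. Proof. exact: measurable_itv. Qed.

Let D_ge0 (x : R) : D x -> 0 <= x.
Proof. by rewrite /= in_itv/= andbT. Qed.

(** For [x >= 0] this is [x ^+ k] times the hyperbolic cosine of [t * Num.sqrt x]. It is kept as a
    series with values in the extended reals so that it can be integrated term by term. *)
Let dom k (x : R) : \bar R :=
  (\sum_(0 <= j <oo) (t ^+ j.*2 / (j.*2)`!%:R * x ^+ (k + j))%:E)%E.

Let coef_ge0 (j : nat) : 0 <= t ^+ j.*2 / (j.*2)`!%:R :> R.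
Proof. by rewrite divr_ge0// -mul2n exprM exprn_ge0// sqr_ge0. Qed.

Let term_ge0 k j x : D x -> 0 <= t ^+ j.*2 / (j.*2)`!%:R * x ^+ (k + j).
Proof. by move=> /D_ge0 x0; rewrite mulr_ge0// exprn_ge0. Qed.

Let mterm k j :
  measurable_fun D (fun x : R => (t ^+ j.*2 / (j.*2)`!%:R * x ^+ (k + j))%:E).
Proof.
by apply/measurable_EFinP/measurable_funM => //; exact: exprn_measurable.
Qed.

(** Integrated term by term, the series is dominated by a geometric one: [fact_add_le] splits
    [(2k + 2j)!] into [(2k)!] and [(2j)!] at the cost of [4 ^+ (k + j)], and [(2j)!] cancels the
    denominator. *)
Lemma integrable_cosine_majorant k : m.-integrable D (dom k).
Proof.
apply/integrableP; split.
  apply: ge0_emeasurable_sum => // j x Dx _; by rewrite lee_fin term_ge0.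
under eq_integral => x /set_mem Dx.
  rewrite gee0_abs; last by apply: nneseries_ge0 => j _ _; rewrite lee_fin term_ge0.
  over.
rewrite /dom integral_nneseries//; last first.
  by move=> j x Dx; rewrite lee_fin term_ge0.
(* The ratio [q] collects what is raised to the power [j], and [a] what depends on [k] alone;
   [q < 1] is the hypothesis [tB]. *)
pose q : R := 4 * t ^+ 2 * B; pose a : R := C * (4 * B) ^+ k * (k.*2)`!%:R.
have q0 : 0 <= q by rewrite mulr_ge0 ?(ltW B0)// mulr_ge0 ?sqr_ge0.
have a0 : 0 <= a by rewrite mulr_ge0// mulr_ge0// exprn_ge0// mulr_ge0// ltW.
apply: (@le_lt_trans _ _ (\sum_(0 <= j <oo) (geometric a q j)%:E)%E).
  apply: lee_nneseries => [j _ _|j _].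
    by apply: integral_ge0 => x Dx; rewrite lee_fin term_ge0.
  under eq_integral do rewrite EFinM.
  rewrite ge0_integralZl_EFin//; last 2 first.
    by move=> x /D_ge0 x0; rewrite lee_fin exprn_ge0.
    by apply/measurable_EFinP; exact: exprn_measurable.
  apply: (@le_trans _ _ ((t ^+ j.*2 / (j.*2)`!%:R)%:E *
      (C * B ^+ (k + j) * (((k + j).*2)`!)%:R)%:E)%E).
    by apply: lee_wpmul2l; rewrite ?lee_fin.
  rewrite -EFinM lee_fin /geometric/=.
  have f0 : 0 < (j.*2)`!%:R :> R by rewrite ltr0n fact_gt0.
  rewrite mulrAC ler_pdivrMr//.
  have := fact_add_le k.*2 j.*2; rewrite -doubleD.
  rewrite -(ler_nat R) !natrM natrX => h.
  apply: (@le_trans _ _ (t ^+ j.*2 * (C * B ^+ (k + j) *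
      (2%:R ^+ (k + j).*2 * ((k.*2)`!%:R * (j.*2)`!%:R))))).
    rewrite ler_wpM2l//; first by rewrite -mul2n exprM exprn_ge0// sqr_ge0.
    by rewrite ler_wpM2l// mulr_ge0// exprn_ge0// ltW.
  rewrite le_eqVlt; apply/orP; left; apply/eqP.
  have four : (4 : R) = 2 * 2 by rewrite -natrM.
  rewrite /q /a four -!mul2n !(exprM _ 2%N) !exprMn !exprD.
  by ring.
rewrite -(_ : (a / (1 - q))%:E = (\sum_(0 <= j <oo) (geometric a q j)%:E)%E) ?ltry//.
apply/esym/cvg_lim => //.
rewrite (_ : (fun _ => _) = EFin \o series (geometric a q)); last first.
  by apply/funext => n /=; rewrite sumEFin.
apply: cvg_EFin; first exact: nearW.
by apply: cvg_geometric_series; rewrite ger0_norm.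
Qed.

(** Cosine is even, so its series at [t * Num.sqrt x] contains only integer powers of [x]. Hence the
    truncated integrals involve [f] only through its integrals against powers. The partial sums are
    dominated by [M * dom k]. *)
Lemma cvg_integral_cosine_series (f : R -> R) (M : R) k : measurable_fun setT f ->
  (forall x, `|f x| <= M) ->
  (\int[m]_(x in D)
     (\sum_(0 <= j < n) (-1) ^+ j * t ^+ j.*2 / (j.*2)`!%:R
        * (f x * x ^+ (k + j)))%:E @[n --> \oo] -->
   \int[m]_(x in D) (f x * cos (t * Num.sqrt x) * x ^+ k)%:E)%E.
Proof.
move=> mf fM.
have mfD : measurable_fun D f by exact: measurable_funTS.
have M0 : 0 <= M by apply: le_trans (fM 0).
have := @dominated_convergence _ _ _ m D mD
  (fun n x => (\sum_(0 <= j < n) (-1) ^+ j * t ^+ j.*2 / (j.*2)`!%:R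
        * (f x * x ^+ (k + j)))%:E)
  (fun x => (f x * cos (t * Num.sqrt x) * x ^+ k)%:E)
  (fun x => M%:E * dom k x)%E.
case=> //.
- move=> n; apply/measurable_EFinP/measurable_sum => j.
  apply: measurable_funM => //; apply: measurable_funM => //.
- apply/measurable_EFinP/measurable_funM; last exact: exprn_measurable.
  apply: measurable_funM => //.
  by apply: measurable_funTS; exact: measurable_cos_sqrt.
- apply: aeW => x /D_ge0 x0; apply: cvg_EFin; first exact: nearW.
  rewrite mulrAC (mulrC (f x * _)).
  apply: cvg_trans (cvgMr_tmp (b := f x * x ^+ k)
    (@cvg_cos_coeff' R (t * Num.sqrt x))).
  apply: near_eq_cvg; apply: nearW => n /=.
  rewrite /series/= mulr_suml; apply: eq_bigr => j _.
  rewrite /cos_coeff' exprMn -[in Num.sqrt x ^+ _]mul2n exprM sqr_sqrtr// exprD.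
  by rewrite -exprnP; ring.
- exact: integrableZl (integrable_cosine_majorant k).
- apply: aeW => x n Dx; have x0 := D_ge0 _ Dx.
  apply: (@le_trans _ _ (M%:E * (\sum_(0 <= j < n)
      (t ^+ j.*2 / (j.*2)`!%:R * x ^+ (k + j))%:E))%E); last first.
    apply: lee_wpmul2l; rewrite ?lee_fin//.
    by apply: nneseries_lim_ge => j _ _; rewrite lee_fin term_ge0.
  rewrite sumEFin -EFinM lee_fin.
  rewrite mulr_sumr (le_trans (ler_norm_sum _ _ _))// ler_sum// => j _.
  rewrite normrM -[X in `|X| * _]mulrA [X in X * _]normrM normrX normrN1.
  rewrite expr1n mul1r [X in X * _]ger0_norm//.
  rewrite mulrCA ler_wpM2l// normrM [X in _ * X]ger0_norm ?exprn_ge0//.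
  by rewrite ler_wpM2r// exprn_ge0.
Qed.

End cosine_series.

(** If [c <= 0], the inner exponential is at least 1 and the whole is at most [expR (- n)]; if
    [c > 0], then [n * expR (- n * c)] tends to 0. The value at [c = 0] falls in the first case,
    whence the strict inequality in the limit. *)
Lemma expR_exp_cvg_indic {R : realType} (c : R) :
  expR (- n%:R * expR (- n%:R * c)) @[n --> \oo] --> ((0 < c)%R%:R : R).
Proof.
have cvgn0 : (n.+1%:R^-1 : R) @[n --> \oo] --> 0 by exact: cvg_harmonic.
have [c0|c0] := ltP 0 c; last first.
  apply: (@squeeze_cvgr _ _ _ _ (cst 0) (fun n : nat => n.+1%:R^-1)) => //.
  - apply: nearW => n; rewrite expR_ge0/=.
    rewrite mulNr expRN lef_pV2 ?posrE ?expR_gt0//.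
    apply: (@le_trans _ _ (expR n%:R)); first by rewrite -natr1 addrC expR_ge1Dx.
    rewrite ler_expR ler_peMr// -expR0 ler_expR.
    by rewrite mulNr -mulrN mulr_ge0// oppr_ge0.
  - exact: cvg_cst.
rewrite -[X in _ --> X](_ : expR 0 = 1); last by rewrite expR0.
apply: continuous_cvg; first exact: continuous_expR.
rewrite -(cvg_shiftS).
(* The bound comes from [y ^+ 2 / 2 <= expR y] at [y = n.+1%:R * c]. *)
apply: (@squeeze_cvgr _ _ _ _ (fun n : nat => - (2 / c ^+ 2 * n.+1%:R^-1)) (cst 0)) => //.
- apply: nearW => n; apply/andP; split; last by rewrite /= mulNr oppr_le0 mulr_ge0// expR_ge0.
  rewrite /= mulNr lerN2 mulNr expRN.
  have nc : 0 < n.+1%:R * c by rewrite mulr_gt0.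
  have h : (n.+1%:R * c) ^+ 2 / 2 <= expR (n.+1%:R * c).
    apply: le_trans (@expR_ge1Dxn R _ 1 (ltW nc)).
    by rewrite lerDr.
  apply: (@le_trans _ _ (n.+1%:R * ((n.+1%:R * c) ^+ 2 / 2)^-1)).
    rewrite ler_wpM2l// lef_pV2 ?posrE ?expR_gt0//.
    by rewrite divr_gt0// exprn_gt0.
  rewrite le_eqVlt; apply/orP; left; apply/eqP; field.
  by rewrite (gt_eqF c0)/= nat1r pnatr_eq0.
- rewrite -[X in _ --> X]oppr0; apply: cvgN.
  by rewrite -[X in _ --> X](mulr0 (2 / c ^+ 2)); apply: cvgMl_tmp.
- exact: cvg_cst.
Qed.

(** * Multipliers and uniqueness of the measure *)

Section stieltjes_determinacy.
Context {R : realType} (m1 m2 : {measure set R -> \bar R}).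
Local Notation D := (`[0%R, +oo[%classic : set R).
Variables (C B : R).
Hypotheses (C0 : 0 <= C) (B0 : 0 < B).
Hypothesis mom1 : forall k,
  (\int[m1]_(x in D) (x ^+ k)%:E <= (C * B ^+ k * (k.*2)`!%:R)%:E)%E.
Hypothesis mom12 : forall k,
  (\int[m1]_(x in D) (x ^+ k)%:E = \int[m2]_(x in D) (x ^+ k)%:E)%E.

Let mom2 k : (\int[m2]_(x in D) (x ^+ k)%:E <= (C * B ^+ k * (k.*2)`!%:R)%:E)%E.
Proof. by rewrite -mom12. Qed.

Let fin1 k : (\int[m1]_(x in D) (x ^+ k)%:E < +oo)%E.
Proof. exact: le_lt_trans (mom1 k) (ltry _). Qed.

Let fin2 k : (\int[m2]_(x in D) (x ^+ k)%:E < +oo)%E.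
Proof. exact: le_lt_trans (mom2 k) (ltry _). Qed.

Let mD : measurable D. Proof. exact: measurable_itv. Qed.

Definition bounded_measurable (f : R -> R) :=
  measurable_fun setT f /\ exists M : R, forall x, `|f x| <= M.

Definition same_moments (f : R -> R) := bounded_measurable f /\
  forall k, (\int[m1]_(x in D) (f x * x ^+ k)%:E =
             \int[m2]_(x in D) (f x * x ^+ k)%:E)%E.

(** The condition is an action on all [same_moments] functions rather than equality of the moments
    of [g] alone; this closes the class under products, which are compositions of actions. *)
Definition multiplier (g : R -> R) := bounded_measurable g /\
  forall f, same_moments f -> same_moments (fun x => f x * g x).

Lemma bounded_measurableM f g : bounded_measurable f -> bounded_measurable g ->
  bounded_measurable (fun x => f x * g x).
Proof.
move=> [mf [M fM]] [mg [M' gM]]; split; first exact: measurable_funM.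
by exists (M * M') => x; rewrite normrM ler_pM.
Qed.

Lemma multiplierM g h : multiplier g -> multiplier h ->
  multiplier (fun x => g x * h x).
Proof.
move=> [bg mg] [bh mh]; split; first exact: bounded_measurableM.
move=> f sf; under eq_fun do rewrite mulrA.
by apply: mh; exact: mg.
Qed.

Lemma multiplierD g h : multiplier g -> multiplier h ->
  multiplier (fun x => g x + h x).
Proof.
move=> [bg mg] [bh mh].
have bgh : bounded_measurable (fun x => g x + h x).
  case: bg bh => [mg' [M gM]] [mh' [M' hM]]; split; first exact: measurable_funD.
  by exists (M + M') => x; rewrite (le_trans (ler_normD _ _))// lerD.
split=> // f sf; split; first exact: bounded_measurableM sf.1 bgh.
have [[mfg [M fgM]] fg] := mg f sf.
have [[mfh [M' fhM]] fh] := mh f sf.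
move=> k; under eq_integral do rewrite mulrDr mulrDl EFinD.
under [RHS]eq_integral do rewrite mulrDr mulrDl EFinD.
rewrite integralD//; [|exact: integrable_mul_power fgM|exact: integrable_mul_power fhM].
rewrite integralD//; [|exact: integrable_mul_power fgM|exact: integrable_mul_power fhM].
by rewrite fg fh.
Qed.

Lemma multiplier_cst c : multiplier (fun=> c).
Proof.
have bc : bounded_measurable (fun=> c).
  by split; [exact: measurable_cst|exists `|c|].
split=> // f sf; split; first exact: bounded_measurableM sf.1 bc.
have [[mf [M fM]] ff] := sf.
move=> k; under eq_integral do rewrite mulrAC mulrC EFinM.
under [RHS]eq_integral do rewrite mulrAC mulrC EFinM.
rewrite integralZl//; last exact: integrable_mul_power fM.
rewrite integralZl//; last exact: integrable_mul_power fM.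
by rewrite ff.
Qed.

(** For fixed [f] and [k], dominated convergence applies under both measures, and the limits of two
    equal sequences coincide. The common bound [M] supplies the majorant. *)
Lemma multiplier_cvg (g_ : nat -> R -> R) (g : R -> R) (M : R) :
  measurable_fun setT g -> (forall x, `|g x| <= M) ->
  (forall n, multiplier (g_ n)) -> (forall n x, `|g_ n x| <= M) ->
  (forall x, 0 <= x -> g_ n x @[n --> \oo] --> g x) ->
  multiplier g.
Proof.
move=> mg gM mg_ g_M g_g.
have bg : bounded_measurable g by split=> //; exists M.
split=> // f sf; split; first exact: bounded_measurableM sf.1 bg.
have [[mf [M' fM]] ff] := sf => k.
have h (m : {measure set R -> \bar R}) :
    (forall k, (\int[m]_(x in D) (x ^+ k)%:E < +oo)%E) ->
    (\int[m]_(x in D) (f x * g_ n x * x ^+ k)%:E @[n --> \oo] -->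
     \int[m]_(x in D) (f x * g x * x ^+ k)%:E)%E.
  move=> mfin; apply: (@cvg_bounded_mul_power R m mfin _ _ (M' * M)) => //.
  - by move=> n; apply: measurable_funM => //; exact: (mg_ n).1.1.
  - exact: measurable_funM.
  - by move=> n x; rewrite normrM ler_pM.
  - by move=> x x0; apply: cvgMl_tmp; exact: g_g.
apply: cvg_unique (h m1 fin1) _; first exact: ereal_hausdorff.
rewrite (_ : (fun n => _) =
  (fun n => \int[m2]_(x in D) (f x * g_ n x * x ^+ k)%:E)%E).
  exact: h.
by apply/funext => n; exact: ((mg_ n).2 f sf).2.
Qed.

Lemma multiplier_sum (n : nat) (g_ : nat -> R -> R) :
  (forall i, multiplier (g_ i)) -> multiplier (fun x => \sum_(0 <= i < n) g_ i x).
Proof.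
move=> mg; elim: n => [|n IHn].
  by under eq_fun do rewrite big_nil; exact: multiplier_cst.
under eq_fun do rewrite big_nat_recr//=.
exact: multiplierD.
Qed.

Lemma multiplierX (n : nat) (g : R -> R) :
  multiplier g -> multiplier (fun x => g x ^+ n).
Proof.
move=> mg; elim: n => [|n IHn].
  by under eq_fun do rewrite expr0; exact: multiplier_cst.
by under eq_fun do rewrite exprS; exact: multiplierM.
Qed.

(** The partial sums of the exponential series are polynomials in [g], hence multipliers, and all of
    them are bounded by [expR M]. *)
Lemma multiplier_expR g : multiplier g -> multiplier (fun x => expR (g x)).
Proof.
move=> mg; have [[meas_g [M gM]] _] := mg.
apply: (@multiplier_cvg (fun n x => series (exp_coeff (g x)) n) _ (expR M)).
- by apply: measurableT_comp => //; exact: measurable_expR.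
- move=> x; rewrite ger0_norm ?expR_ge0// ler_expR.
  exact: le_trans (ler_norm _) (gM x).
- move=> n; apply: multiplier_sum => i; apply: multiplierM.
    exact: multiplierX.
  exact: multiplier_cst.
- move=> n x.
  have le_series (y : R) k : 0 <= y -> series (exp_coeff y) k <= expR y.
    move=> y0; rewrite /expR.
    apply: nondecreasing_cvgn_le; last exact: is_cvg_series_exp_coeff.
    by apply/nondecreasing_seqP => i; rewrite seriesSr lerDl exp_coeff_ge0.
  have := congr1 (fun h => h n) (normed_series_exp_coeff (g x)); rewrite /= => E.
  apply: (@le_trans _ _ (series (exp_coeff `|g x|) n)).
    by rewrite -E /series/=; exact: ler_norm_sum.
  by rewrite (le_trans (le_series _ _ _))// ler_expR.
- by move=> x _; rewrite /expR; exact: is_cvg_series_exp_coeff.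
Qed.

(** Each truncated cosine series integrates to a finite combination of integrals of
    [f x * x ^+ (k + j)], on which the two measures agree; so their limits agree. *)
Lemma multiplier_cos_sqrt t : 4 * t ^+ 2 * B < 1 ->
  multiplier (fun x => cos (t * Num.sqrt x)).
Proof.
move=> tB; have bc : bounded_measurable (fun x => cos (t * Num.sqrt x)).
  split; first exact: measurable_cos_sqrt.
  by exists 1 => x; rewrite ler_norml cos_geN1 cos_le1.
split=> // f sf; split; first exact: bounded_measurableM sf.1 bc.
have [[mf [M fM]] ff] := sf => k.
have cvg1 := @cvg_integral_cosine_series R m1 C B t C0 B0 tB mom1 f M k mf fM.
apply: cvg_unique cvg1 _; first exact: ereal_hausdorff.
rewrite (_ : (fun n => _) = (fun n => \int[m2]_(x in D)
     (\sum_(0 <= j < n) (-1) ^+ j * t ^+ j.*2 / (j.*2)`!%:R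
        * (f x * x ^+ (k + j)))%:E)%E).
  exact: (@cvg_integral_cosine_series R m2 C B t C0 B0 tB mom2 f M k mf fM).
apply/funext => n.
have E (m : {measure set R -> \bar R}) :
    (forall k, (\int[m]_(x in D) (x ^+ k)%:E < +oo)%E) ->
    (\int[m]_(x in D) (\sum_(0 <= j < n) (-1) ^+ j * t ^+ j.*2 / (j.*2)`!%:R
        * (f x * x ^+ (k + j)))%:E = \sum_(0 <= j < n)
     ((-1) ^+ j * t ^+ j.*2 / (j.*2)`!%:R)%:E *
       \int[m]_(x in D) (f x * x ^+ (k + j))%:E)%E.
  move=> mfin.
  under eq_integral do rewrite -sumEFin.
  rewrite integral_sum//.
    apply: eq_bigr => j _; under eq_integral do rewrite EFinM.
    by rewrite integralZl//; exact: integrable_mul_power fM.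
  move=> j; apply: (@integrableZl _ _ _ m D mD _
    (fun x => (f x * x ^+ (k + j))%:E)).
  exact: integrable_mul_power fM.
by rewrite !E//; apply: eq_bigr => j _; rewrite ff.
Qed.

(** The square of [Num.sqrt x] is [x] for [x >= 0] and 0 for negative [x], which keeps the function
    bounded by 1 on the whole line. *)
Lemma multiplier_expRN : multiplier (fun x => expR (- (Num.sqrt x ^+ 2))).
Proof.
(* The cosine is used below at [t = 2 * h n], so [4 * t ^+ 2 * B = 16 * B * h n ^+ 2]. Starting the
   sequence [h] at [1 / N.+1] makes this less than 1 for every [n]. *)
have [N NB] : exists N : nat, 16 * B < N.+1%:R.
  by exists (Num.truncn (16 * B)); exact: truncnS_gt.
pose h n : R := (N + n).+1%:R^-1.
have h0 n : h n != 0 by rewrite invr_eq0 pnatr_eq0.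
have cvgh : h n @[n --> \oo] --> 0.
  have := @cvg_harmonic R; rewrite -(cvg_shiftn N).
  by under eq_fun do rewrite addnC.
apply: (@multiplier_cvg
  (fun n x => expR (- (sin (h n * Num.sqrt x) / h n) ^+ 2)) _ 1).
- apply: continuous_measurable_fun => x.
  apply: continuous_comp; last exact: continuous_expR.
  apply: cvgN; rewrite expr2; apply: cvgM; exact: sqrt_continuous.
- by move=> x; rewrite ger0_norm ?expR_ge0// -expR0 ler_expR oppr_le0 sqr_ge0.
- move=> n; apply: multiplier_expR.
  (* The half-angle formula turns the squared sine into an affine function of a cosine, already
     known to be a multiplier. *)
  have sin2E y : - (sin (h n * y) / h n) ^+ 2 =
      (cos (2 * h n * y) + - 1) * (2 * h n ^+ 2)^-1.
    rewrite -mulrA mulr_natl cos_mulr2n cos2sin2.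
    by field; rewrite h0.
  under eq_fun do rewrite sin2E.
  apply: multiplierM; last exact: multiplier_cst.
  apply: multiplierD; last exact: multiplier_cst.
  apply: multiplier_cos_sqrt.
  have hN : h n <= N.+1%:R^-1.
    by rewrite lef_pV2 ?posrE// ler_nat ltnS leq_addr.
  have hn0 : 0 <= h n by rewrite invr_ge0.
  have h1 : h n <= 1 by rewrite invf_le1// ler1n.
  have h2 : h n ^+ 2 <= N.+1%:R^-1.
    by apply: le_trans hN; rewrite expr2 ler_piMr.
  have N0 : 0 < N.+1%:R :> R by [].
  rewrite exprMn -natrX.
  apply: (@le_lt_trans _ _ (16 * B * N.+1%:R^-1)); last by rewrite ltr_pdivrMr// mul1r.
  rewrite (_ : 4 * ((2 ^ 2)%:R * h n ^+ 2) * B = 16 * B * h n ^+ 2); last first.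
    rewrite (_ : (2 ^ 2)%:R = 4 :> R)//; ring.
  by rewrite ler_wpM2l// mulr_ge0// ltW.
- by move=> n x; rewrite ger0_norm ?expR_ge0// -expR0 ler_expR oppr_le0 sqr_ge0.
- move=> x _; apply: continuous_cvg; first exact: continuous_expR.
  apply: cvgN; rewrite !expr2; under eq_fun do rewrite expr2.
  by apply: cvgM; exact: cvg_sinMr_div.
Qed.

Lemma multiplier_initial_segment b : 0 <= b -> multiplier \1_(`]-oo, b[%classic : set R).
Proof.
move=> b0.
(* For [x >= 0], [c x] is positive exactly when [x < b]. The inner exponential below is large where
   [c] is negative, but the outer one keeps the sequence between 0 and 1, as [multiplier_cvg]
   demands. *)
pose c (x : R) := expR (- (Num.sqrt x ^+ 2)) - expR (- b).
have mc : multiplier c by apply: multiplierD; [exact: multiplier_expRN|exact: multiplier_cst].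
apply: (@multiplier_cvg (fun n x => expR (- n%:R * expR (- n%:R * c x))) _ 1).
- by apply: measurable_indic; exact: measurable_itv.
- by move=> x; rewrite indicE; case: (_ \in _); rewrite ?normr1 ?normr0.
- move=> n; apply: multiplier_expR; apply: multiplierM; first exact: multiplier_cst.
  apply: multiplier_expR; apply: multiplierM; first exact: multiplier_cst.
  exact: mc.
- move=> n x; rewrite ger0_norm ?expR_ge0// -[leRHS]expR0 ler_expR mulNr oppr_le0.
- move=> x x0; rewrite (_ : \1__ x = (0 < c x)%R%:R); first exact: expR_exp_cvg_indic.
  rewrite indicE; congr (nat_of_bool _)%:R; apply/idP/idP.
    by move=> /set_mem /=; rewrite in_itv/= => xb; rewrite subr_gt0 ltr_expR ltrN2 sqr_sqrtr.
  rewrite subr_gt0 ltr_expR ltrN2 sqr_sqrtr// => xb; apply/mem_set.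
  by rewrite /= in_itv.
Qed.

(** The constant 1 is a [same_moments] function by [mom12]. Multiplying it by the indicator and
    reading off the moment of order 0 gives the measures. *)
Lemma same_measure_initial_segment b : 0 <= b ->
  m1 (`[0, b[%classic) = m2 (`[0, b[%classic).
Proof.
move=> b0.
have s1 : same_moments (fun=> 1).
  split; first exact: (multiplier_cst 1).1.
  by move=> k; under eq_integral do rewrite mul1r;
     under [RHS]eq_integral do rewrite mul1r.
have [_ /(_ 0%N)] := (multiplier_initial_segment b b0).2 _ s1.
under eq_integral do rewrite mul1r expr0 mulr1.
under [RHS]eq_integral do rewrite mul1r expr0 mulr1.
rewrite !integral_indic//.
rewrite (_ : _ `&` _ = `[0, b[%classic)//.
by apply/seteqP; split => x /=; rewrite !in_itv/= ?andbT; [move=> [-> ->]|move=> /andP[-> ->]].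
Qed.

End stieltjes_determinacy.

(** Open left rays are stable under intersection and generate the Borel sets, and those with natural
    endpoints exhaust the line with finite [m1] mass; so agreement on rays suffices. A ray carries
    only the mass of its part in [[0, +oo[]. *)
Theorem stieltjes_hardy_unique {R : realType} (m1 m2 : {measure set R -> \bar R})
    (C B : R) : 0 <= C -> 0 < B ->
  (m1 setT < +oo)%E -> m1 `]-oo, 0[%classic = 0%E -> m2 `]-oo, 0[%classic = 0%E ->
  (forall k, (\int[m1]_(x in `[0%R, +oo[) (x ^+ k)%:E <=
     (C * B ^+ k * (k.*2)`!%:R)%:E)%E) ->
  (forall k, (\int[m1]_(x in `[0%R, +oo[) (x ^+ k)%:E =
     \int[m2]_(x in `[0%R, +oo[) (x ^+ k)%:E)%E) ->
  forall A : set R, measurable A -> m1 A = m2 A.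
Proof.
move=> C0 B0 m1T m1_0 m2_0 mom1 mom12 A mA.
apply: (@measure_unique _ _ _ (@RGenInftyO.G R) (fun k => `]-oo, k%:R[%classic)) => //.
- exact: RGenInftyO.measurableE.
- move=> _ _ [x ->] [y ->]; exists (Num.min x y).
  by apply/seteqP; split => z /=; rewrite !in_itv/= lt_min => /andP.
- by move=> i; exists i%:R.
- apply/seteqP; split => // x _; exists (Num.truncn `|x|).+1 => //=.
  by rewrite in_itv/= (le_lt_trans (ler_norm _))// truncnS_gt.
- move=> _ [b ->]; have [b0|b0] := leP 0 b; last first.
    have sub : (`]-oo, b[%classic : set R) `<=` `]-oo, 0[%classic.
      by move=> x /=; rewrite !in_itv/= => xb; exact: lt_trans xb b0.
    by rewrite !(subset_measure0 _ _ sub)//; exact: measurable_itv.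
  have E (m : {measure set R -> \bar R}) : m `]-oo, 0[%classic = 0%E ->
      m `]-oo, b[%classic = m `[0, b[%classic.
    move=> m0; rewrite (_ : `]-oo, b[%classic = `]-oo, 0[%classic `|` `[0, b[%classic).
      rewrite measureU//; first by rewrite [X in (X + _)%E](_ : _ = 0%E) ?add0e.
      apply/seteqP; split => // x /=; rewrite !in_itv/= => -[x0] /andP[].
      by rewrite leNgt x0.
    apply/seteqP; split => x /=; rewrite !in_itv/=.
      by move=> ->; rewrite andbT; case: ltP; [left|right].
    by move=> [x0|/andP[]//]; exact: lt_le_trans x0 b0.
  by rewrite !E//; exact: (@same_measure_initial_segment R m1 m2 C B).
- by move=> k; apply: le_lt_trans m1T; rewrite le_measure ?inE.
Qed.

(** * Moments of random sums *)

Section weighted_domination.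
Context {d : measure_display} {T : measurableType d} {R : realType}.
Variables (P : {measure set T -> \bar R}) (W phi : T -> R) (E : set T) (c : R).
Hypotheses (mW : measurable_fun setT W) (W_ge0 : forall x, 0 <= W x).
Hypotheses (mphi : measurable_fun setT phi) (mE : measurable E) (c_ge0 : 0 <= c).
Hypothesis dom : forall A : set R, measurable A ->
  (\int[P]_(x in E `&` phi @^-1` A) (W x)%:E <= c%:E * P (phi @^-1` A))%E.

Import HBNNSimple.

Let mpre (A : set R) : measurable A -> measurable (phi @^-1` A).
Proof. by move=> mA; rewrite -(setTI (_ @^-1` _)); exact: mphi. Qed.

(** Both sides are split along the finitely many values of [f]; on each level set the inequality is
    [dom]. *)
Lemma weighted_nnsfun_le (f : {nnsfun R >-> R}) :
  (\int[P]_(x in E) (W x * f (phi x))%:E <= c%:E * \int[P]_x (f (phi x))%:E)%E.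
Proof.
have mpref k : measurable (phi @^-1` (f @^-1` [set k])) by exact: mpre.
have mind k : measurable_fun setT (fun x => \1_(f @^-1` [set k]) (phi x) : R).
  exact: (measurable_indic (mpref k)).
have lhsE : (\int[P]_(x in E) (W x * f (phi x))%:E =
    \sum_(k \in range f) k%:E *
      \int[P]_(x in E `&` phi @^-1` (f @^-1` [set k])) (W x)%:E)%E.
  transitivity (\int[P]_(x in E) \sum_(k \in range f)
      (W x * (k * \1_(f @^-1` [set k]) (phi x)))%:E)%E.
    apply: eq_integral => x _; rewrite {1}fimfunE fsumEFin//.
    by congr EFin; rewrite !fsbig_finite//= mulr_sumr.
  rewrite ge0_integral_fsum//; last 2 first.
  - move=> k; apply/measurable_EFinP/measurable_funM.
      exact: measurable_funTS.
    by apply: measurable_funM => //; exact: measurable_funTS.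
  - move=> k x _; have := nnfun_muleindic_ge0 f k (phi x).
    by rewrite !lee_fin => ?; rewrite mulr_ge0.
  apply: eq_fsbigr => k /set_mem [y _ fyk].
  have k0 : 0 <= k by rewrite -fyk.
  rewrite integral_mkcondr -ge0_integralZl_EFin//; last 2 first.
  - by move=> x _; rewrite patchE; case: ifP => // _; rewrite lee_fin.
  - apply/measurable_restrict => //.
    by apply/measurable_EFinP; exact: measurable_funTS.
  apply: eq_integral => x _; rewrite patchE indicE.
  rewrite (_ : (phi x \in _) = (x \in phi @^-1` (f @^-1` [set k])))//.
  case: ifP => _; first by rewrite -EFinM mulr1 mulrC.
  by rewrite !mulr0 mule0.
have rhsE : (\int[P]_x (f (phi x))%:E =
    \sum_(k \in range f) k%:E * P (phi @^-1` (f @^-1` [set k])))%E.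
  transitivity (\int[P]_x \sum_(k \in range f)
      (k * \1_(f @^-1` [set k]) (phi x))%:E)%E.
    by apply: eq_integral => x _; rewrite {1}fimfunE fsumEFin.
  rewrite ge0_integral_fsum//; last 2 first.
  - move=> k; apply/measurable_EFinP; exact: measurable_funM.
  - by move=> k x _; exact: (nnfun_muleindic_ge0 f k (phi x)).
  apply: eq_fsbigr => k /set_mem [y _ fyk].
  have k0 : 0 <= k by rewrite -fyk.
  under eq_integral do rewrite EFinM.
  rewrite ge0_integralZl_EFin//; last first.
    exact/measurable_EFinP.
  congr (_ * _)%E.
  have := integral_indic P measurableT (mpref k); rewrite setIT => <-.
  exact: eq_integral.
rewrite lhsE rhsE.
rewrite !fsbig_finite//= ge0_sume_distrr; last first.
  move=> k _; have [k0|k0] := leP 0 k; first by rewrite mule_ge0.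
  by rewrite preimage_nnfun0// preimage_set0 measure0 mule0.
apply: lee_sum => k _; rewrite muleCA; have [k0|k0] := leP 0 k.
  by apply: lee_wpmul2l; [rewrite lee_fin|exact: dom].
by rewrite preimage_nnfun0// preimage_set0 setI0 measure0 integral_set0 !mule0.
Qed.

(** Monotone convergence along simple functions increasing to [g]. With [W] a power of a partial sum
    and [phi] the next summand, this lets independence, which is given for events, control the
    integral of a product. *)
Lemma weighted_integral_le (g : R -> R) : measurable_fun setT g ->
  (forall x, 0 <= g x) ->
  (\int[P]_(x in E) (W x * g (phi x))%:E <= c%:E * \int[P]_x (g (phi x))%:E)%E.
Proof.
move=> mg g0.
have mEg : measurable_fun setT (EFin \o g) by exact/measurable_EFinP.
pose f n := nnsfun_approx measurableT mEg n.
have f_le n x : f n x <= g x.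
  rewrite -lee_fin /f nnsfun_approxE.
  by apply: (@le_approx _ _ _ _ (EFin \o g)) => // y _; rewrite lee_fin.
have f_cvg x : f n x @[n --> \oo] --> g x.
  have := @cvg_nnsfun_approx _ _ _ _ measurableT _ mEg.
  move=> /(_ (fun y _ => g0 y) x Logic.I).
  by move=> /fine_cvgP[].
have mfphi n : measurable_fun setT (fun x => f n (phi x)) by exact: measurableT_comp.
have -> : (\int[P]_(x in E) (W x * g (phi x))%:E =
    limn (fun n => \int[P]_(x in E) (W x * f n (phi x))%:E))%E.
  rewrite -monotone_convergence//.
  - apply: eq_integral => x _; apply/esym/cvg_lim => //.
    by apply: cvg_EFin; [exact: nearW|apply: cvgMl_tmp; exact: f_cvg].
  - move=> n; apply/measurable_EFinP; apply: measurable_funTS.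
    exact: measurable_funM.
  - by move=> n x _; rewrite lee_fin mulr_ge0.
  - move=> x _ a b ab; rewrite lee_fin ler_wpM2l//.
    by apply/lefP; exact: nd_nnsfun_approx.
apply: lime_le.
  apply: ereal_nondecreasing_is_cvgn => a b ab.
  apply: ge0_le_integral => //.
  - by move=> x _; rewrite lee_fin mulr_ge0.
  - by apply/measurable_EFinP; apply: measurable_funTS; exact: measurable_funM.
  - by apply/measurable_EFinP; apply: measurable_funTS; exact: measurable_funM.
  - move=> x _; rewrite lee_fin ler_wpM2l//.
    by apply/lefP; exact: nd_nnsfun_approx.
apply: nearW => n; apply: le_trans (weighted_nnsfun_le (f n)) _.
apply: lee_wpmul2l; first by rewrite lee_fin.
apply: ge0_le_integral => //.
- by move=> x _; rewrite lee_fin.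
- exact/measurable_EFinP.
- by apply/measurable_EFinP; exact: measurableT_comp.
- by move=> x _; rewrite lee_fin.
Qed.

End weighted_domination.

Lemma fact_le_expn n : (n`! <= n ^ n)%N.
Proof.
suff h j : (j <= n)%N -> (j`! <= n ^ j)%N by exact: h.
elim: j => [//|j IHj jn]; rewrite factS expnS.
by rewrite leq_mul// IHj// ltnW.
Qed.

(** From [j = 2] on, consecutive terms have ratio at most [k * z <= 1], so each is at most
    [2 * z ^+ 2]. There are fewer than [k] of them, and [k * z ^+ 2 <= z]. *)
Lemma sum_fact_expr_le {R : realFieldType} (z : R) (k : nat) :
  0 <= z -> k%:R * z <= 1 ->
  \sum_(j < k.+1) j`!%:R * z ^+ j <= 1 + 3 * z.
Proof.
move=> z0 kz.
have term j : (2 <= j)%N -> (j <= k)%N -> j`!%:R * z ^+ j <= 2 * z ^+ 2.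
  elim: j => // j IHj; rewrite leq_eqVlt => /orP[/eqP<- _//|j2 jk].
  rewrite factS natrM exprS mulrACA; apply: le_trans (IHj j2 (ltnW jk)).
  rewrite ler_piMl ?mulr_ge0 ?exprn_ge0//; apply: le_trans kz.
  by rewrite ler_wpM2r// ler_nat.
have partial n : (n <= k)%N ->
    \sum_(j < n.+1) j`!%:R * z ^+ j <= 1 + z + 2 * z ^+ 2 * n%:R.
  elim: n => [_|n IHn nk].
    by rewrite big_ord1 fact0 expr0 !mulr1 mulr0 addr0 lerDl.
  rewrite big_ord_recr/=; case: n IHn nk => [_ _|n IHn nk].
    rewrite big_ord1 fact0 expr0 expr1 !mulr1 mul1r lerDl mulr_ge0 ?sqr_ge0//.
  apply: le_trans (lerD (IHn (ltnW nk)) (term _ _ nk)) _ => //.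
  by rewrite -[n.+2%:R]natr1 mulrDr mulr1 addrA.
apply: le_trans (partial k (leqnn k)) _.
have : z * (k%:R * z) <= z by rewrite ler_piMr.
by rewrite expr2; lra.
Qed.

(** * Moments of fixed and of random sums *)

Section random_sum_moments.
Context {d : measure_display} {T : measurableType d} {R : realType}.
Variables (P : probability T R) (Z : nat -> T -> R) (N : T -> nat) (a : R).
Hypotheses (mZ : forall i, measurable_fun setT (Z i)).
Hypotheses (Z_ge0 : forall i w, 0 <= Z i w).
Hypotheses (mN : forall n, measurable (N @^-1` [set n])).
Hypotheses (indep : indep_family P Z N) (a_ge0 : 0 <= a).
Hypothesis momZ : forall i j,
  (\int[P]_w (Z i w ^+ j)%:E <= (a ^+ j * j`!%:R ^+ 2)%:E)%E.

Local Notation S n w := (\sum_(i < n) Z i w).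

Let S_ge0 n w : 0 <= S n w.
Proof. exact: sumr_ge0. Qed.

Let mS n : measurable_fun setT (fun w => S n w).
Proof. exact: measurable_sum. Qed.

Let mNset (B : set nat) : measurable (N @^-1` B).
Proof.
rewrite (_ : N @^-1` B = \bigcup_(n in B) N @^-1` [set n]).
  by apply: bigcup_measurable => n _; exact: mN.
apply/seteqP; split=> [w Bw|w [n Bn /= Nn]]; first by exists (N w).
by rewrite /preimage/= Nn.
Qed.

(** Arbitrary sets [A i] are allowed because the induction over the number of summands restricts the
    newest variable while the earlier ones stay free. *)
Let event m B (A : nat -> set R) : set T :=
  [set w | (forall i, (i < m)%N -> A i (Z i w)) /\ B (N w)].

Let mevent m B A : (forall i, measurable (A i)) -> measurable (event m B A).
Proof.
move=> mA; rewrite (_ : event m B A =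
  (\bigcap_(i in [set i | (i < m)%N]) Z i @^-1` A i) `&` N @^-1` B)//.
apply: measurableI => //; apply: bigcap_measurableType => i _.
by rewrite -(setTI (_ @^-1` _)); exact: mZ.
Qed.

Let event_set1 m B A (A' : set R) (n : nat) : (n < m)%N -> A n = setT ->
  event m B A `&` Z n @^-1` A' = event m B (fun i => if i == n then A' else A i).
Proof.
move=> nm AT; apply/seteqP; split=> [w [[h1 h2] h3]|w [h1 h2]].
  by split=> // i im; case: eqP => [->//|_]; exact: h1.
split; last by have := h1 n nm; rewrite eqxx.
split=> // i im; have [->|ni] := eqVneq i n; first by rewrite AT.
by have := h1 i im; rewrite (negbTE ni).
Qed.

Let event_prob m B A (A' : set R) (n : nat) : (n < m)%N -> A n = setT ->
  (forall i, measurable (A i)) -> measurable A' ->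
  (P (event m B (fun i => if i == n then A' else A i)) =
   P (event m B A) * P (Z n @^-1` A'))%E.
Proof.
move=> nm AT mA mA'; rewrite /event (indep m _ B mA).
rewrite (indep m (fun i => if i == n then A' else A i) B); last first.
  by move=> i; case: ifP.
rewrite (bigD1 (Ordinal nm))//= [in RHS](bigD1 (Ordinal nm))//= eqxx AT.
rewrite preimage_setT probability_setT mul1e.
under eq_bigr => i ni.
  rewrite (_ : (val i == n) = false); last by apply/negbTE.
  over.
by rewrite -muleA muleC.
Qed.

(** Induction on [n] through the binomial expansion of the last summand. The events range over all
    [A] leaving the first [n] variables free, since the induction hypothesis is used on events that
    restrict [Z n]. Each new summand costs a factor [1 + 3 * z]. *)
Lemma sum_moment_event (m K : nat) (z : R) (B : set nat) :
  0 < z -> K%:R * z <= 1 ->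
  forall n k A, (n <= m)%N -> (k <= K)%N -> (forall i, measurable (A i)) ->
    (forall i, (i < n)%N -> A i = setT) ->
  (\int[P]_(w in event m B A) (S n w ^+ k)%:E <=
   (k`!%:R * (a / z) ^+ k * (1 + 3 * z) ^+ n)%:E * P (event m B A))%E.
Proof.
move=> z0 Kz; have az0 : 0 <= a / z by rewrite divr_ge0// ltW.
elim=> [|n IHn] k A nm kK mA AT.
  under eq_integral do rewrite big_ord0 expr0n.
  rewrite integral_cst; last exact: mevent.
  rewrite lee_wpmul2r// lee_fin expr0 mulr1; case: k kK => [|k] kK /=; last first.
    by rewrite mulr_ge0// exprn_ge0.
  by rewrite fact0 mul1r.
have mE := mevent m B A mA.
pose c i : R := i`!%:R * (a / z) ^+ i * (1 + 3 * z) ^+ n.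
have c0 i : 0 <= c i.
  by rewrite mulr_ge0 ?exprn_ge0 ?addr_ge0 ?mulr_ge0 ?exprn_ge0// ltW.
have finE : P (event m B A) \is a fin_num by exact: fin_num_measure.
(* Independence enters here: [IHn] on the event cut down by [Z n] in [A'], followed by [event_prob],
   is the domination required by [weighted_integral_le], and the moment of [Z n] splits off. *)
have step j : (j <= k)%N ->
  (\int[P]_(w in event m B A) (S n w ^+ (k - j) * Z n w ^+ j)%:E <=
   (c (k - j)%N * (a ^+ j * j`!%:R ^+ 2))%:E * P (event m B A))%E.
  move=> jk.
  have := @weighted_integral_le _ _ _ P (fun w => S n w ^+ (k - j)) (Z n)
    (event m B A) (c (k - j)%N * fine (P (event m B A))) _ _ _ mE _ _
    (fun x => `|x| ^+ j) _ _.
  (* The test function must be nonnegative on the whole line, hence the absolute value. *)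
  rewrite (_ : (\int[P]_(w in event m B A) (S n w ^+ (k - j) * Z n w ^+ j)%:E)%E =
    (\int[P]_(w in event m B A) (S n w ^+ (k - j) * `|Z n w| ^+ j)%:E)%E); last first.
    by apply: eq_integral => w _; rewrite ger0_norm.
  move=> h; apply: le_trans; first apply: h.
  - exact: measurable_funX.
  - by move=> w; rewrite exprn_ge0.
  - by [].
  - by rewrite mulr_ge0// fine_ge0.
  - move=> A' mA'; rewrite event_set1//; last exact: AT.
    apply: le_trans; first apply: IHn; first exact: ltnW.
    + by rewrite (leq_trans (leq_subr _ _)).
    + by move=> i; case: ifP.
    + move=> i i_n; rewrite (ltn_eqF i_n); apply: AT; exact: ltnW.
    rewrite event_prob//; last exact: AT.
    by rewrite muleA [in leRHS]EFinM fineK.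
  - by apply: measurable_funX; exact: normr_measurable.
  - by move=> x; rewrite exprn_ge0.
  rewrite [in leLHS]EFinM fineK// muleAC [in leRHS](EFinM (c _)).
  rewrite lee_wpmul2r// lee_wpmul2l ?lee_fin//.
  under eq_integral do rewrite ger0_norm//.
  exact: momZ.
have -> : (\int[P]_(w in event m B A) (S n.+1 w ^+ k)%:E =
    \sum_(j < k.+1) 'C(k, j)%:R%:E *
    \int[P]_(w in event m B A) (S n w ^+ (k - j) * Z n w ^+ j)%:E)%E.
  transitivity (\int[P]_(w in event m B A) \sum_(j < k.+1)
    'C(k, j)%:R%:E * (S n w ^+ (k - j) * Z n w ^+ j)%:E)%E.
    apply: eq_integral => w _; rewrite big_ord_recr/= exprDn -sumEFin.
    by apply: eq_bigr => j _; rewrite -EFinM mulr_natl.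
  have mterm j : measurable_fun (event m B A)
      (fun w => (S n w ^+ (k - j) * Z n w ^+ j)%:E).
    apply/measurable_EFinP; apply: measurable_funTS.
    by apply: measurable_funM; exact: measurable_funX.
  rewrite ge0_integral_sum//; last 2 first.
  - by move=> j; apply: measurable_funeM.
  - by move=> j w _; rewrite mule_ge0// lee_fin ?mulr_ge0 ?exprn_ge0.
  apply: eq_bigr => j _; rewrite ge0_integralZl_EFin//.
  by move=> w _; rewrite lee_fin mulr_ge0 ?exprn_ge0.
apply: (@le_trans _ _ (\sum_(j < k.+1) ('C(k, j)%:R *
    (c (k - j)%N * (a ^+ j * j`!%:R ^+ 2)))%:E * P (event m B A))%E).
  apply: lee_sum => j _; rewrite EFinM -muleA; apply: lee_wpmul2l.
    by rewrite lee_fin.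
  by apply: step; rewrite -ltnS.
rewrite -ge0_sume_distrl; last first.
  move=> j _; rewrite lee_fin mulr_ge0// mulr_ge0// mulr_ge0 ?exprn_ge0//.
rewrite lee_wpmul2r// sumEFin lee_fin.
(* The binomial coefficient, [(k - j)!] and one of the two factors [j!] combine into [k!]; the
   missing [j] powers of [1 / z] are restored by [z ^+ j]. *)
rewrite (_ : \sum_(j < k.+1) _ = k`!%:R * (a / z) ^+ k * (1 + 3 * z) ^+ n *
    \sum_(j < k.+1) j`!%:R * z ^+ j); last first.
  rewrite mulr_sumr; apply: eq_bigr => j _.
  have jk : (j <= k)%N by rewrite -ltnS.
  rewrite -(bin_fact jk) !natrM /c.
  rewrite -[in (a / z) ^+ k](subnK jk) exprD !exprMn !exprVn.
  have zn0 i : z ^+ i != 0 by rewrite expf_neq0// gt_eqF.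
  move: (z ^+ (k - j)) (z ^+ j) (zn0 (k - j)%N) (zn0 j) => u v u0 v0.
  by field; rewrite u0 v0.
rewrite exprSr mulrA; apply: ler_wpM2l.
  by rewrite mulr_ge0 ?mulr_ge0 ?exprn_ge0// addr_ge0// mulr_ge0// ltW.
apply: sum_fact_expr_le; first exact: ltW.
by apply: le_trans Kz; apply: ler_wpM2r; [exact: ltW|rewrite ler_nat].
Qed.

(* The free parameter is [z = min (1 / k, k / m)], which balances the growth of
   [z ^- k] against that of [(1 + 3 z) ^ m]. *)
Lemma sum_moment_index (k m : nat) :
  (\int[P]_(w in N @^-1` [set m]) (S m w ^+ k)%:E <=
   ((a * expR 3) ^+ k * (k%:R ^+ k.*2 + m%:R ^+ k))%:E * P (N @^-1` [set m]))%E.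
Proof.
have eventT : event m [set m] (fun=> setT) = N @^-1` [set m].
  by apply/seteqP; split=> [w []//|w]; split.
have [->|k0] := posnP k.
  under eq_integral do rewrite expr0.
  rewrite integral_cst//= lee_wpmul2r// lee_fin !expr0 mul1r.
  by rewrite lerDl.
have bound (z : R) : 0 < z -> k%:R * z <= 1 ->
    (\int[P]_(w in N @^-1` [set m]) (S m w ^+ k)%:E <=
     (k`!%:R * (a / z) ^+ k * (1 + 3 * z) ^+ m)%:E * P (N @^-1` [set m]))%E.
  by move=> z0 kz; rewrite -eventT; apply: (@sum_moment_event m k z).
have kR : 0 < k%:R :> R by rewrite ltr0n.
have factk : k`!%:R <= k%:R ^+ k :> R.
  by rewrite -natrX ler_nat fact_le_expn.
(* Used with [x = 3 * z]: both choices of [z] satisfy [z * m <= k]. *)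
have exp_le (x : R) : 0 <= x -> x * m%:R <= 3 * k%:R -> (1 + x) ^+ m <= expR 3 ^+ k.
  move=> x0 xm; apply: (@le_trans _ _ (expR x ^+ m)).
    by apply: lerXn2r; rewrite ?nnegrE ?addr_ge0 ?expR_ge0// expR_ge1Dx.
  by rewrite -!expRM_natr ler_expR.
(* For [m <= k * k] the minimum is [1 / k], and [k! * k ^ k] gives the term [k ^ (2k)]. Otherwise it
   is [k / m], where [k!] is absorbed by [k ^ k] and [m ^ k] remains. *)
have [mk|km] := leqP m (k * k).
  apply: le_trans (bound k%:R^-1 _ _) _; rewrite ?invr_gt0 ?mulfV ?gt_eqF//.
  rewrite lee_wpmul2r// lee_fin invrK !exprMn -addnn exprD.
  have E_le : (1 + 3 / k%:R) ^+ m <= expR 3 ^+ k :> R.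
    apply: exp_le; first by rewrite divr_ge0.
    by rewrite -mulrA ler_wpM2l// mulrC ler_pdivrMr// -natrM ler_nat.
  have E_ge0 : 0 <= (1 + 3 / k%:R) ^+ m :> R.
    by rewrite exprn_ge0// addr_ge0// divr_ge0.
  have FE := ler_pM (ler0n R k`!) E_ge0 factk E_le.
  have aK : 0 <= a ^+ k * k%:R ^+ k by rewrite mulr_ge0 ?exprn_ge0.
  have M0 : 0 <= a ^+ k * expR 3 ^+ k * m%:R ^+ k.
    by rewrite !mulr_ge0 ?exprn_ge0 ?expR_ge0.
  rewrite mulrDr; apply: le_trans (_ : _ <= a ^+ k * expR 3 ^+ k * (k%:R ^+ k * k%:R ^+ k)) _.
    rewrite [leLHS](_ : _ = a ^+ k * k%:R ^+ k * (k`!%:R * (1 + 3 / k%:R) ^+ m)); last by ring.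
    rewrite [leRHS](_ : _ = a ^+ k * k%:R ^+ k * (k%:R ^+ k * expR 3 ^+ k)); last by ring.
    exact: ler_wpM2l.
  by rewrite lerDl.
have mR : 0 < m%:R :> R by rewrite ltr0n (leq_ltn_trans _ km).
apply: le_trans (bound (k%:R / m%:R) _ _) _; first by rewrite divr_gt0.
  by rewrite mulrA ler_pdivrMr// mul1r -natrM ler_nat ltnW.
rewrite lee_wpmul2r// lee_fin invf_div !exprMn exprVn.
have E_le : (1 + 3 * (k%:R / m%:R)) ^+ m <= expR 3 ^+ k :> R.
  apply: exp_le; first by rewrite mulr_ge0// divr_ge0.
  by rewrite -!mulrA mulVf ?mulr1// gt_eqF.
have E_ge0 : 0 <= (1 + 3 * (k%:R / m%:R)) ^+ m :> R.
  by rewrite exprn_ge0// addr_ge0// mulr_ge0// divr_ge0.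
have F_le1 : k`!%:R / k%:R ^+ k <= 1 :> R by rewrite ler_pdivrMr ?mul1r// exprn_gt0.
have F_ge0 : 0 <= k`!%:R / k%:R ^+ k :> R by rewrite divr_ge0// exprn_ge0.
have FE := ler_pM F_ge0 E_ge0 F_le1 E_le.
have aM : 0 <= a ^+ k * m%:R ^+ k by rewrite mulr_ge0 ?exprn_ge0.
have K0 : 0 <= a ^+ k * expR 3 ^+ k * k%:R ^+ k.*2.
  by rewrite !mulr_ge0 ?exprn_ge0 ?expR_ge0.
rewrite mulrDr; apply: le_trans (_ : _ <= a ^+ k * expR 3 ^+ k * m%:R ^+ k) _.
  rewrite [leLHS](_ : _ = a ^+ k * m%:R ^+ k *
    (k`!%:R / k%:R ^+ k * (1 + 3 * (k%:R / m%:R)) ^+ m)); last by ring.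
  rewrite [leRHS](_ : _ = a ^+ k * m%:R ^+ k * (1 * expR 3 ^+ k)); last by ring.
  exact: ler_wpM2l.
by rewrite lerDr.
Qed.

Lemma measurable_random_sum : measurable_fun setT (random_sum Z N).
Proof.
rewrite (_ : setT = \bigcup_n (N @^-1` [set n])); last first.
  by apply/seteqP; split=> // w _; exists (N w).
apply/measurable_fun_bigcup => // n.
apply: (eq_measurable_fun (fun w => S n w)).
  by move=> w /set_mem /= Nn; rewrite /random_sum Nn.
exact: measurable_funTS.
Qed.

(** Both integrals are split over the values of [N] and compared piece by piece with
    [sum_moment_index]. *)
Lemma random_sum_moment (k : nat) :
  (\int[P]_w (random_sum Z N w ^+ k)%:E <=
   \int[P]_w ((a * expR 3) ^+ k * (k%:R ^+ k.*2 + (N w)%:R ^+ k))%:E)%E.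
Proof.
have mNR : measurable_fun setT (fun w => (N w)%:R : R).
  move=> _ Y mY; rewrite setTI.
  exact: (mNset [set n | Y n%:R]).
have cover : \bigcup_n (N @^-1` [set n]) = setT.
  by apply/seteqP; split=> // w _; exists (N w).
have triv : trivIset setT (fun n => N @^-1` [set n]).
  by move=> i j _ _ [w [/= <- <-]].
rewrite -cover ge0_integral_bigcup//; last 2 first.
- rewrite cover; apply/measurable_EFinP; apply: measurable_funX.
  exact: measurable_random_sum.
- by move=> w _; rewrite lee_fin exprn_ge0//; exact: S_ge0.
rewrite ge0_integral_bigcup//; last 2 first.
- rewrite cover; apply/measurable_EFinP; apply: measurable_funM => //.
  by apply: measurable_funD => //; exact: measurable_funX.
- move=> w _; rewrite lee_fin mulr_ge0 ?addr_ge0 ?exprn_ge0//.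
  by rewrite mulr_ge0// expR_ge0.
apply: lee_nneseries => [m _ _|m _].
  by apply: integral_ge0 => w _; rewrite lee_fin exprn_ge0//; exact: S_ge0.
under eq_integral => w /set_mem /= Nm do rewrite /random_sum Nm.
under [leRHS]eq_integral => w /set_mem /= Nm do rewrite Nm.
by rewrite integral_cst//; exact: sum_moment_index.
Qed.

Lemma random_sum_moment_growth (C b : R) : 0 <= C -> 0 < b -> 0 < a ->
  (forall k, (\int[P]_w ((N w)%:R ^+ k)%:E <= (C * b ^+ k * (k.*2)`!%:R)%:E)%E) ->
  forall k, (\int[P]_w (random_sum Z N w ^+ k)%:E <=
    ((1 + C) * (a * expR 3 * (expR 2 + b)) ^+ k * (k.*2)`!%:R)%:E)%E.
Proof.
move=> C0 b0 a0 momN k; apply: le_trans (random_sum_moment k) _.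
have mNR : measurable_fun setT (fun w => (N w)%:R : R).
  move=> _ Y mY; rewrite setTI.
  exact: (mNset [set n | Y n%:R]).
under eq_integral do rewrite EFinM EFinD.
have D0 : 0 <= (a * expR 3) ^+ k by rewrite exprn_ge0// mulr_ge0// expR_ge0.
rewrite ge0_integralZl_EFin//; last 2 first.
- by move=> w _; rewrite -EFinD lee_fin addr_ge0 ?exprn_ge0.
- by apply/measurable_EFinP; apply: measurable_funD => //; exact: measurable_funX.
rewrite ge0_integralD//; last first.
  by apply/measurable_EFinP; exact: measurable_funX.
rewrite integral_cst//= probability_setT mule1.
apply: (@le_trans _ _ (((a * expR 3) ^+ k)%:E *
    ((k%:R ^+ k.*2)%:E + (C * b ^+ k * (k.*2)`!%:R)%:E))%E).
  by rewrite lee_wpmul2l ?lee_fin// leeD2l.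
rewrite -EFinD -EFinM lee_fin [leRHS](_ : _ = (a * expR 3) ^+ k *
  ((1 + C) * ((expR 2 + b) ^+ k * (k.*2)`!%:R))); last first.
  by rewrite [(a * expR 3 * _) ^+ k]exprMn; ring.
rewrite ler_wpM2l// -mulrA.
have f0 : 0 < (k.*2)`!%:R :> R by rewrite ltr0n fact_gt0.
(* The quotient [(2k) ^ (2k) / (2k)!] is one term of the series of [expR (2 * k)]. *)
have kk : k%:R ^+ k.*2 <= expR 2 ^+ k * (k.*2)`!%:R :> R.
  rewrite -ler_pdivrMr//; case: k {D0 f0} => [|k]; first by rewrite !expr0 fact0 divr1.
  rewrite -expRM_natr; apply: (@le_trans _ _ ((2 * k.+1%:R) ^+ (k.+1).*2 / (k.+1).*2`!%:R)).
    rewrite ler_wpM2r// lerXn2r ?nnegrE ?mulr_ge0//.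
    by rewrite ler_peMl// ler1n.
  have := @expR_ge1Dxn R (2 * k.+1%:R) (k.*2.+1) (mulr_ge0 (ler0n _ _) (ler0n _ _)).
  by apply: le_trans; rewrite -doubleS lerDr.
have e2 : 0 <= expR 2 :> R by exact: expR_ge0.
have le1 : expR 2 ^+ k <= (expR 2 + b) ^+ k.
  by rewrite lerXn2r ?nnegrE ?addr_ge0 ?lerDl// ltW.
have le2 : b ^+ k <= (expR 2 + b) ^+ k.
  by rewrite lerXn2r ?nnegrE ?addr_ge0 ?lerDr// ltW.
apply: (@le_trans _ _ (expR 2 ^+ k * (k.*2)`!%:R + C * (b ^+ k * (k.*2)`!%:R))).
  by rewrite lerD2r.
rewrite mulrDl mul1r; apply: lerD; first by rewrite ler_wpM2r// ltW.
by rewrite ler_wpM2l// ler_wpM2r// ltW.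
Qed.

End random_sum_moments.

(** * Moments from tails *)

Lemma liminf_pinfty_gt_near {R : realType} (f : R -> \bar R) (a : \bar R) :
  (a < liminf_pinfty f)%E -> \forall x \near +oo, (a < f x)%E.
Proof.
rewrite /liminf_pinfty limf_einfE => /ereal_sup_gt[_ [V FV <-]] aV.
apply: filterS FV => x Vx; apply: lt_le_trans aV _.
by apply: ereal_inf_lbound; exists x.
Qed.

(** The factor 1/2 is a choice of a constant below the limit inferior 1. Positivity of [h], needed
    to clear the denominator, comes from its divergence. *)
Lemma natural_scale_half_le_Rfun {d : measure_display} {T : measurableType d}
    {R : realType} (P : probability T R) (Y : T -> R) (h : R -> R) :
  natural_scale P Y h ->
  \forall x \near +oo, 0 < h x /\ ((h x / 2)%:E <= Rfun P Y x)%E.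
Proof.
move=> [_ [_ [_ [h_oo li]]]].
have : ((2^-1)%:E < liminf_pinfty (fun x => (Rfun P Y x * ((h x)^-1)%:E)%E))%E.
  by rewrite li lte_fin invf_lt1// ltr1n.
move=> /liminf_pinfty_gt_near h2.
have h0 : \forall x \near +oo, 0 < h x by move/cvgryPgt : h_oo; exact.
near=> x; have hx : 0 < h x by near: x.
split=> //; have : (2^-1%:E < Rfun P Y x * ((h x)^-1)%:E)%E by near: x.
case: (Rfun P Y x) => [r| |]; last 2 first.
- by move=> _; exact: leey.
- by rewrite gt0_mulNye ?lte_fin ?invr_gt0.
by rewrite -EFinM lte_fin lee_fin ltr_pdivlMr// => /ltW; rewrite mulrC.
Unshelve. all: by end_near. Qed.

Lemma measurable_tail_event {d : measure_display} {T : measurableType d}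
    {R : realType} (Y : T -> R) (x : R) :
  measurable_fun setT Y -> measurable [set w | x < Y w].
Proof.
move=> mY; have := mY measurableT _ (measurable_itv `]x, +oo[); rewrite setTI.
by congr measurable; apply/seteqP; split => w /=; rewrite in_itv/= andbT.
Qed.

Lemma tailP_le_of_Rfun {d : measure_display} {T : measurableType d}
    {R : realType} (P : probability T R) (Y : T -> R) (x t : R) :
  measurable_fun setT Y -> (t%:E <= Rfun P Y x)%E ->
  (tailP P Y x <= (expR (- t))%:E)%E.
Proof.
move=> mY; rewrite /Rfun; case: ifPn => [/eqP-> _|p0].
  by rewrite lee_fin expR_ge0.
have mYx := measurable_tail_event Y x mY.
have finp : tailP P Y x \is a fin_num by exact: fin_num_measure.
rewrite -(fineK finp) !lee_fin lerNr => lnp.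
have pp : 0 < fine (tailP P Y x).
  by rewrite fine_gt0// lt0e p0 measure_ge0/= ltey_eq finp.
by rewrite -[leLHS]lnK ?posrE// ler_expR.
Qed.

Section stretched_exponential_tail.
Context {d : measure_display} {T : measurableType d} {R : realType}.
Variable (P : probability T R).

(** The tail makes the expectation of [expR (a * sqrt Y)] finite for [a = c / 2], and [Y ^+ k] is at
    most [a ^- (2k) * (2k)!] times that exponential. The constants are chosen before [Y], so that
    one pair serves all the summands. *)
Lemma moment_growth_of_tail (c K : R) : 0 < c -> 0 <= K ->
  exists C b : R, 0 <= C /\ 0 < b /\ forall Y : T -> R,
    measurable_fun setT Y -> (forall w, 0 <= Y w) ->
    (forall n : nat, (tailP P Y (n%:R ^+ 2) <= (K * expR (- (c * n%:R)))%:E)%E) ->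
    forall k, (\int[P]_w (Y w ^+ k)%:E <= (C * b ^+ k * (k.*2)`!%:R)%:E)%E.
Proof.
move=> c0 K0; pose a := c / 2; have a0 : 0 < a by rewrite divr_gt0.
pose q : R := expR (- a); have q0 : 0 <= q by exact: expR_ge0.
have q1 : q < 1 by rewrite expR_lt1 oppr_lt0.
(* The first term covers [sqrt Y < 1]. The second sums [K * expR (a * (n + 2)) * expR (- c * n)],
   which is geometric of ratio [q] because [c = 2 * a]. *)
pose C := expR a + K * expR (2 * a) / (1 - q).
have C0 : 0 <= C.
  by rewrite addr_ge0 ?expR_ge0// divr_ge0 ?mulr_ge0 ?expR_ge0// subr_ge0 ltW.
exists C, (a ^- 2); split=> //; split; first by rewrite invr_gt0 exprn_gt0.
move=> Y mY Y0 tl k.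
have mset n : measurable [set w | n%:R ^+ 2 < Y w].
  exact: measurable_tail_event.
have mexp : measurable_fun setT (fun w => expR (a * Num.sqrt (Y w))).
  apply: (measurableT_comp (f := fun y : R => expR (a * Num.sqrt y))) => //.
  apply: continuous_measurable_fun => x.
  apply: continuous_comp; last exact: continuous_expR.
  by apply: cvgMl_tmp; exact: sqrt_continuous.
(* If [sqrt Y] has integer part [n + 1], then [sqrt Y < n + 2] and [Y > n ^ 2]. The event uses [n]
   rather than [n + 1] because the tail is strict. *)
pose g n w : \bar R := ((expR (a * n.+2%:R))%:E * (\1_[set w | n%:R ^+ 2 < Y w] w)%:E)%E.
have mg n : measurable_fun setT (g n).
  by apply: measurable_funeM; apply/measurable_EFinP; exact: measurable_indic.
have g0 n w : (0 <= g n w)%E by rewrite mule_ge0// lee_fin expR_ge0.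
have pointwise w : ((expR (a * Num.sqrt (Y w)))%:E <=
    (expR a)%:E + \sum_(0 <= n <oo) g n w)%E.
  have : (Num.truncn (Num.sqrt (Y w)))%:R <= Num.sqrt (Y w).
    by rewrite truncn_le sqrtr_ge0.
  move: (truncnS_gt (Num.sqrt (Y w))).
  case: (Num.truncn _) => [|n] tgt tle.
    apply: (@le_trans _ _ (expR a)%:E).
      by rewrite lee_fin ler_expR ler_piMr// ltW.
    by rewrite leeDl// nneseries_ge0.
  apply: (@le_trans _ _ (g n w)).
    rewrite /g indicE mem_set/= ?mule1; last first.
      rewrite -[ltRHS]sqr_sqrtr// ltrXn2r ?nnegrE ?sqrtr_ge0//.
      by apply: lt_le_trans tle; rewrite ltr_nat.
    by rewrite lee_fin ler_expR ler_wpM2l// ltW.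
  apply: (@le_trans _ _ (\sum_(0 <= n <oo) g n w)%E); last by rewrite leeDr// lee_fin expR_ge0.
  apply: le_trans (nneseries_lim_ge n.+1 _) => //.
  by rewrite big_nat_recr//= leeDr// sume_ge0.
have expY : (\int[P]_w (expR (a * Num.sqrt (Y w)))%:E <= C%:E)%E.
  apply: (@le_trans _ _ (\int[P]_w ((expR a)%:E + \sum_(0 <= n <oo) g n w))%E).
    apply: ge0_le_integral => //.
    - exact/measurable_EFinP.
    - by apply: emeasurable_funD => //; apply: ge0_emeasurable_sum.
  rewrite ge0_integralD//; last 2 first.
  - by move=> w _; rewrite nneseries_ge0.
  - exact: ge0_emeasurable_sum.
  rewrite integral_cst//= probability_setT mule1 /C EFinD leeD2l//.
  rewrite integral_nneseries//.
  apply: (@le_trans _ _ (\sum_(0 <= n <oo) (geometric (K * expR (2 * a)) q n)%:E)%E).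
    apply: lee_nneseries => [n _ _|n _]; first exact: integral_ge0.
    rewrite ge0_integralZl_EFin//; last first.
      by apply/measurable_EFinP; exact: measurable_indic.
    rewrite integral_indic// setIT.
    apply: (@le_trans _ _ ((expR (a * n.+2%:R))%:E * (K * expR (- (c * n%:R)))%:E)%E).
      by rewrite lee_wpmul2l ?lee_fin ?expR_ge0//; exact: tl.
    rewrite -EFinM lee_fin /geometric/= /q -expRM_natr mulrCA -!mulrA ler_wpM2l//.
    rewrite -!expRD ler_expR -addn2 natrD /a.
    by rewrite le_eqVlt; apply/orP; left; apply/eqP; field.
  rewrite (_ : (\sum_(0 <= n <oo) _)%E = (K * expR (2 * a) / (1 - q))%:E)//.
  apply/cvg_lim => //.
  rewrite (_ : (fun _ => _) = EFin \o series (geometric (K * expR (2 * a)) q)); last first.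
    by apply/funext => n /=; rewrite sumEFin.
  apply: cvg_EFin; first exact: nearW.
  by apply: cvg_geometric_series; rewrite ger0_norm.
have f0 : 0 < (k.*2)`!%:R :> R by rewrite ltr0n fact_gt0.
have ab0 : 0 <= a ^- 2 ^+ k * (k.*2)`!%:R.
  by rewrite mulr_ge0// exprn_ge0// invr_ge0 exprn_ge0// ltW.
apply: (@le_trans _ _ (\int[P]_w ((a ^- 2 ^+ k * (k.*2)`!%:R)%:E *
    (expR (a * Num.sqrt (Y w)))%:E))%E).
  apply: ge0_le_integral => //.
  - by move=> w _; rewrite lee_fin exprn_ge0.
  - by apply/measurable_EFinP; exact: measurable_funX.
  - by apply: measurable_funeM; exact/measurable_EFinP.
  move=> w _; rewrite -EFinM lee_fin.
  pose s := Num.sqrt (Y w); have s0 : 0 <= s by exact: sqrtr_ge0.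
  have -> : Y w ^+ k = s ^+ k.*2 by rewrite -mul2n exprM sqr_sqrtr.
  have as0 : 0 <= a * s by rewrite mulr_ge0// ltW.
  have h : (a * s) ^+ k.*2 / (k.*2)`!%:R <= expR (a * s).
    case: k {f0 ab0} => [|k]; first by rewrite expr0 fact0 divr1 -expR0 ler_expR.
    have := @expR_ge1Dxn R (a * s) k.*2.+1 as0.
    by apply: le_trans; rewrite doubleS lerDr.
  rewrite (_ : s ^+ k.*2 = a ^- 2 ^+ k * (k.*2)`!%:R *
    ((a * s) ^+ k.*2 / (k.*2)`!%:R)); first exact: ler_wpM2l.
  have an0 : a ^+ k.*2 != 0 by rewrite expf_neq0// gt_eqF.
  rewrite exprVn -exprM mul2n (exprMn _ a s).
  move: (a ^+ k.*2) an0 => u u0; field.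
  by rewrite u0 gt_eqF.
rewrite ge0_integralZl_EFin//; last exact/measurable_EFinP.
apply: (@le_trans _ _ ((a ^- 2 ^+ k * (k.*2)`!%:R)%:E * C%:E)%E).
  by rewrite lee_wpmul2l ?lee_fin.
by rewrite -EFinM lee_fin mulrC mulrA.
Qed.

Lemma tail_growth_of_near (c : R) (Y : T -> R) : 0 < c -> measurable_fun setT Y ->
  (\forall x \near +oo, (tailP P Y x <= (expR (- (c * Num.sqrt x)))%:E)%E) ->
  exists2 K : R, 0 <= K & forall n : nat,
    (tailP P Y (n%:R ^+ 2) <= (K * expR (- (c * n%:R)))%:E)%E.
Proof.
move=> c0 mY [M [_ tl]]; pose n0 := (Num.truncn `|M|).+1.
have Mn0 : M < n0%:R by rewrite (le_lt_trans (ler_norm _))// truncnS_gt.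
(* With this [K] the bound is at least 1 for [n < n0], where only [tailP <= 1] is known. *)
exists (expR (c * n0%:R)) => [|n]; first exact: expR_ge0.
rewrite -expRD; have [n0n|nn0] := leqP n0 n.
  have Mn : M < n%:R ^+ 2.
    apply: lt_le_trans Mn0 _; rewrite -natrX ler_nat (leq_trans n0n)//.
    by rewrite leq_pmulr// (leq_trans _ n0n).
  apply: le_trans (tl _ Mn) _; rewrite sqrtr_sqr ger0_norm// lee_fin ler_expR.
  by rewrite lerDr mulr_ge0// ltW.
have mset : measurable [set w | n%:R ^+ 2 < Y w].
  exact: measurable_tail_event.
apply: le_trans (probability_le1 P mset) _.
rewrite lee_fin -[leLHS]expR0 ler_expR -mulrBr mulr_ge0 ?(ltW c0)//.
by rewrite subr_ge0 ler_nat ltnW.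
Qed.

End stretched_exponential_tail.

(** * From natural scales to tails *)

Lemma liminf_ratio_gt0_near {R : realType} (f g : R -> R) :
  (0 < liminf_pinfty (fun x => (f x / g x)%:E))%E ->
  (\forall x \near +oo, 0 < g x) ->
  exists2 e, 0 < e & \forall x \near +oo, e * g x <= f x.
Proof.
move=> li g0.
(* Half of the limit inferior if it is finite, 1 if it is infinite. *)
have [e e0 eli] : exists2 e : R, 0 < e &
    (e%:E < liminf_pinfty (fun x => (f x / g x)%:E))%E.
  move: li; case: (liminf_pinfty _) => [r| |]//.
    rewrite lte_fin => r0; exists (r / 2); first by rewrite divr_gt0.
    by rewrite lte_fin ltr_pdivrMr// ltr_pMr// ltr1n.
  by move=> _; exists 1 => //; exact: ltry.
exists e => //; move/liminf_pinfty_gt_near : eli => eli; near=> x.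
have gx : 0 < g x by near: x.
have : (e%:E < (f x / g x)%:E)%E by near: x.
by rewrite lte_fin ltr_pdivlMr// => /ltW.
Unshelve. all: by end_near. Qed.

Lemma near_pinfty_divr {R : realType} (c : R) (Q : R -> Prop) : 0 < c ->
  (\forall x \near +oo, Q x) -> \forall x \near +oo, Q (x / c).
Proof.
move=> c0 [M [_ MQ]]; exists (M * c); split; first exact: num_real.
by move=> x Mx; apply: MQ; rewrite ltr_pdivlMr.
Qed.

Lemma near_sqrt_gt0 {R : realType} : \forall x \near +oo, 0 < Num.sqrt (x : R).
Proof.
by near=> x; rewrite sqrtr_gt0; near: x; exact: nbhs_pinfty_gt.
Unshelve. all: by end_near. Qed.

(** Evaluating at [x / c] trades the dilation for the factor [Num.sqrt c^-1]; the scale of the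
    counting variable is controlled only at dilated arguments. *)
Lemma sqrt_le_rescale {R : realType} (h : R -> R) (c e : R) : 0 < c ->
  (\forall x \near +oo, e * Num.sqrt x <= h (c * x)) ->
  \forall x \near +oo, e * Num.sqrt c^-1 * Num.sqrt x <= h x.
Proof.
move=> c0 /(near_pinfty_divr _ _ c0); apply: filterS => x.
rewrite mulrCA mulfV ?gt_eqF// mulr1 [x / c]mulrC sqrtrM ?mulrA//.
by rewrite invr_ge0 ltW.
Qed.

Lemma natural_scale_sqrt_tail {d : measure_display} {T : measurableType d}
    {R : realType} (P : probability T R) (Y : T -> R) (h : R -> R) (e : R) :
  measurable_fun setT Y -> natural_scale P Y h -> 0 < e ->
  (\forall x \near +oo, e * Num.sqrt x <= h x) ->
  exists c K : R, [/\ 0 < c, 0 <= K & forall n : nat,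
    (tailP P Y (n%:R ^+ 2) <= (K * expR (- (c * n%:R)))%:E)%E].
Proof.
move=> mY /natural_scale_half_le_Rfun hR e0 eh.
have e20 : 0 < e / 2 by rewrite divr_gt0.
have [|K K0 tl] := @tail_growth_of_near _ _ _ P (e / 2) Y e20 mY.
  near=> x; apply: tailP_le_of_Rfun => //.
  have [_] : 0 < h x /\ ((h x / 2)%:E <= Rfun P Y x)%E by near: x.
  apply: le_trans; rewrite lee_fin mulrAC ler_wpM2r//.
  by near: x.
by exists (e / 2), K; split.
Unshelve. all: by end_near. Qed.

(** * Transfer between random variables and their laws *)

Lemma integral_pushforward_nonneg {d : measure_display} {T : measurableType d}
    {R : realType} (P : probability T R) (S : {mfun T >-> R}) (k : nat) :
  P [set w | S w < 0] = 0%E ->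
  (\int[pushforward P S]_(x in `[0%R, +oo[) (x ^+ k)%:E =
   'E_P[fun w => (S w ^+ k)%R])%E.
Proof.
move=> S0; have mS : measurable_fun setT S by [].
have mpre : measurable (S @^-1` `[0, +oo[).
  by rewrite -(setTI (_ @^-1` _)); exact: mS.
have mneg : measurable [set w | S w < 0].
  rewrite (_ : [set _ | _] = ~` (S @^-1` `[0, +oo[)); first exact: measurableC.
  apply/seteqP; split => w /=; rewrite in_itv/= andbT ltNge; first by move/negP.
  by move=> /negP.
rewrite ge0_integral_pushforward//; last 2 first.
- by apply/measurable_EFinP; exact: exprn_measurable.
- by move=> x /set_mem /=; rewrite in_itv/= andbT => x0; rewrite lee_fin exprn_ge0.
(* [S] is nonnegative only almost surely, so restricting to [S >= 0] changes the integrand on a null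
   set. *)
rewrite unlock integral_mkcond; apply: ae_eq_integral => //.
- apply/(measurable_restrictT _ _).1 => //; apply: measurable_funTS.
  by apply/measurable_EFinP; exact: measurable_funX.
- by apply/measurable_EFinP; exact: measurable_funX.
exists [set w | S w < 0]; split=> // w /= nw.
rewrite ltNge; apply/negP => Sw; apply: nw => _.
by rewrite patchE mem_set//= in_itv/= andbT.
Qed.

Lemma determined_of_moment_growth {d : measure_display} {T : measurableType d}
    {R : realType} (P : probability T R) (S : T -> R) (C b : R) :
  measurable_fun setT S -> P [set w | S w < 0] = 0%E -> 0 <= C -> 0 < b ->
  (forall k, ('E_P[(fun w => S w ^+ k)%R] <= (C * b ^+ k * (k.*2)`!%:R)%:E)%E) ->
  determined_by_moments P S.
Proof.
move=> mS S0 C0 b0 mom; split=> //; split=> //; split.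
  by move=> k; exact: le_lt_trans (mom k) (ltry _).
move=> d' T' Q Y mY Y0 QP A mA.
pose S' : {mfun T >-> R} := HB.pack S (isMeasurableFun.Build _ _ _ _ S mS).
pose Y' : {mfun T' >-> R} := HB.pack Y (isMeasurableFun.Build _ _ _ _ Y mY).
apply/esym; apply: (@stieltjes_hardy_unique R (pushforward P S') (pushforward Q Y') C b) => //.
- by rewrite [ltLHS](_ : _ = P setT)// probability_setT ltry.
- by move=> k; rewrite integral_pushforward_nonneg//; exact: mom.
- by move=> k; rewrite !integral_pushforward_nonneg//; exact/esym/QP.
Qed.

(** Converts moment growth into the shape [a ^+ j * j! ^+ 2] used in the induction over summands.
    The constant [C] is absorbed into the [j]-th power, which requires [j > 0]. *)
Lemma power_fact_double_le {R : realFieldType} (C b : R) (j : nat) :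
  0 <= C -> 0 <= b -> (0 < j)%N ->
  C * b ^+ j * (j.*2)`!%:R <= ((1 + C) * 4 * b) ^+ j * j`!%:R ^+ 2.
Proof.
move=> C0 b0 j0.
have C1 : C <= (1 + C) ^+ j.
  apply: (@le_trans _ _ (1 + C)); first by rewrite lerDr.
  by rewrite ler_eXnr// lerDl.
have F : (j.*2)`!%:R <= 4 ^+ j * j`!%:R ^+ 2 :> R.
  have := fact_add_le j j; rewrite -(ler_nat R) addnn !natrM natrX.
  by rewrite -mul2n exprM -natrX.
rewrite !exprMn [leRHS](_ : _ =
  (1 + C) ^+ j * b ^+ j * (4 ^+ j * j`!%:R ^+ 2)); last by ring.
rewrite ler_pM ?mulr_ge0 ?exprn_ge0// ler_wpM2r// exprn_ge0//.
Qed.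

(** * Tails under either alternative, and reduction to nonnegative summands *)

Theorem theorem2p12 (d : measure_display) (T : measurableType d) (R : realType)
  (P : probability T R) (X : T -> R) (Xs : nat -> T -> R) (N : T -> nat) :
  measurable_fun setT X ->
  (forall w, 0 <= X w) ->
  heavy_tailed P X ->
  (forall i, measurable_fun setT (Xs i)) ->
  (forall i (A : set R), measurable A -> P (Xs i @^-1` A) = P (X @^-1` A)) ->
  (forall n, measurable (N @^-1` [set n])) ->
  (forall w, (0 < N w)%N) ->
  heavy_tailed P (fun w => (N w)%:R) ->
  indep_family P Xs N ->
  ((exists hX : R -> R, natural_scale P X hX /\
       (0 < liminf_pinfty (fun x => (hX x / Num.sqrt x)%:E))%E /\
     exists (hN : R -> R) (c1 : R), natural_scale P (fun w => (N w)%:R) hN /\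
       (c1%:E > 'E_P[X])%E /\
       (0 < liminf_pinfty (fun x => ((hN (c1 * x) / hX x)%R)%:E))%E)
   \/
   (exists m : R, ('E_P[X] = m%:E)%E /\
     exists hN : R -> R, natural_scale P (fun w => (N w)%:R) hN /\
       (0 < liminf_pinfty (fun x => ((hN (m * x) / Num.sqrt x)%R)%:E))%E /\
     exists hX : R -> R, natural_scale P X hX /\
       (0 < liminf_pinfty (fun x => (hX x / hN (m * x))%:E))%E)) ->
  determined_by_moments P (random_sum Xs N).
Proof.
move=> mX X0 _ mXs lawX mN _ _ indep scales.
have mNR : measurable_fun setT (fun w => (N w)%:R : R).
  move=> _ Y mY; rewrite setTI (_ : _ @^-1` Y =
      \bigcup_(n in [set n | Y n%:R]) N @^-1` [set n]).
    by apply: bigcup_measurable => n _; exact: mN.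
  by apply/seteqP; split=> [w Yw|w [n Yn /= Nn]]; [exists (N w)|rewrite /= Nn].
(* Either alternative is used only through these tails: one scale dominates the square root, and the
   other dominates the first. *)
have [[cX [KX [cX0 KX0 tX]]] [cN [KN [cN0 KN0 tN]]]] :
   (exists c K : R, [/\ 0 < c, 0 <= K & forall n : nat,
      (tailP P X (n%:R ^+ 2) <= (K * expR (- (c * n%:R)))%:E)%E]) /\
   (exists c K : R, [/\ 0 < c, 0 <= K & forall n : nat,
      (tailP P (fun w => (N w)%:R) (n%:R ^+ 2) <=
       (K * expR (- (c * n%:R)))%:E)%E]).
  case: scales => [[hX [sX [liX [hN [c1 [sN [c1X liN]]]]]]]|].
    have [e e0 eX] := liminf_ratio_gt0_near _ _ liX near_sqrt_gt0.
    have hX0 : \forall x \near +oo, 0 < hX x.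
      by apply: filterS (natural_scale_half_le_Rfun _ _ _ sX) => x [].
    have [e' e'0 eN] := liminf_ratio_gt0_near _ _ liN hX0.
    have c10 : 0 < c1.
      rewrite -lte_fin; apply: le_lt_trans c1X; rewrite unlock.
      by apply: integral_ge0 => w _; rewrite lee_fin.
    split; first exact: (natural_scale_sqrt_tail P X hX e).
    apply: (natural_scale_sqrt_tail P _ hN (e' * e * Num.sqrt c1^-1)) => //.
      by rewrite !mulr_gt0// sqrtr_gt0 invr_gt0.
    apply: sqrt_le_rescale => //; near=> x.
    apply: (@le_trans _ _ (e' * hX x)); last by near: x.
    by rewrite -mulrA ler_wpM2l ?(ltW e'0)//; near: x.
  move=> [m [mE [hN [sN [liN [hX [sX liX]]]]]]].
  have [e e0 eN] := liminf_ratio_gt0_near _ _ liN near_sqrt_gt0.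
  have m0 : 0 < m.
    rewrite lt_neqAle; apply/andP; split; last first.
      rewrite -lee_fin -mE unlock.
      by apply: integral_ge0 => w _; rewrite lee_fin.
    (* If [m] were 0, [hN (m * x)] would be [hN 0 = 0], against the lower bound by a positive
       multiple of [Num.sqrt x]. *)
    apply/eqP => m0; have [x [/= sx ex]] : exists x : R,
        0 < Num.sqrt x /\ e * Num.sqrt x <= hN (m * x).
      have : \forall x \near +oo, 0 < Num.sqrt x /\ e * Num.sqrt x <= hN (m * x).
        by near=> x; split; near: x => //; exact: near_sqrt_gt0.
      by move=> /filter_ex.
    by move: ex; rewrite -m0 mul0r sN.2.2.1 leNgt mulr_gt0.
  have hN0 : \forall x \near +oo, 0 < hN (m * x).
    near=> x; apply: (@lt_le_trans _ _ (e * Num.sqrt x)); last by near: x.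
    by rewrite mulr_gt0//; near: x; exact: near_sqrt_gt0.
  have [e' e'0 eX] := liminf_ratio_gt0_near _ _ liX hN0.
  split.
    apply: (natural_scale_sqrt_tail P X hX (e' * e)) => //; first exact: mulr_gt0.
    near=> x; apply: (@le_trans _ _ (e' * hN (m * x))); last by near: x.
    by rewrite -mulrA ler_wpM2l ?(ltW e'0)//; near: x.
  apply: (natural_scale_sqrt_tail P _ hN (e * Num.sqrt m^-1)) => //.
    by rewrite mulr_gt0// sqrtr_gt0 invr_gt0.
  exact: sqrt_le_rescale.
have [CX [bX [CX0 [bX0 momX]]]] := moment_growth_of_tail P cX KX cX0 KX0.
have [CN [bN [CN0 [bN0 momN]]]] := moment_growth_of_tail P cN KN cN0 KN0.
(* The [Xs i] share the law of [X], so they are nonnegative only almost surely; absolute values are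
   nonnegative everywhere and keep law and independence. The value of [a] is the base in
   [power_fact_double_le]. *)
pose Z i w := `|Xs i w|; pose a : R := (1 + CX) * 4 * bX.
have a0 : 0 < a by rewrite !mulr_gt0// ltr_pwDl.
have mZ i : measurable_fun setT (Z i).
  by apply: measurableT_comp => //; exact: normr_measurable.
have mnorm (A : set R) : measurable A -> measurable ((Num.norm : R -> R) @^-1` A).
  by move=> mA; rewrite -(setTI (_ @^-1` _)); exact: normr_measurable.
have indepZ : indep_family P Z N.
  by move=> n A B mA; apply: (indep n (fun i => (Num.norm : R -> R) @^-1` A i) B) => i; exact: mnorm.
have momZ i j : (\int[P]_w (Z i w ^+ j)%:E <= (a ^+ j * j`!%:R ^+ 2)%:E)%E.
  have [->|j0] := posnP j.
    under eq_integral do rewrite expr0.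
    by rewrite integral_cst//= probability_setT mule1 expr0 fact0 mul1r expr1n.
  have tZ n : (tailP P (Z i) (n%:R ^+ 2) <= (KX * expR (- (cX * n%:R)))%:E)%E.
    apply: le_trans (tX n); rewrite le_eqVlt; apply/orP; left; apply/eqP.
    have := lawX i ((Num.norm : R -> R) @^-1` `]n%:R ^+ 2, +oo[) (mnorm _ (measurable_itv _)).
    have -> : X @^-1` ((Num.norm : R -> R) @^-1` `]n%:R ^+ 2, +oo[) =
        [set w | n%:R ^+ 2 < X w].
      by apply/seteqP; split=> w /=; rewrite in_itv/= andbT ger0_norm.
    have -> : Xs i @^-1` ((Num.norm : R -> R) @^-1` `]n%:R ^+ 2, +oo[) =
        [set w | n%:R ^+ 2 < Z i w].
      by apply/seteqP; split=> w /=; rewrite in_itv/= andbT.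
    by [].
  apply: le_trans (momX (Z i) (mZ i) (fun w => normr_ge0 _) tZ j) _.
  by rewrite lee_fin power_fact_double_le// ltW.
have growth := random_sum_moment_growth P Z N a mZ (fun i w => normr_ge0 _) mN indepZ
  (ltW a0) momZ CN bN CN0 bN0 a0 (momN _ mNR (fun w => ler0n _ _) tN).
have mS := measurable_random_sum Xs N mXs mN.
have mS' := measurable_random_sum Z N mZ mN.
have neg0 i : P [set w | Xs i w < 0] = 0%E.
  have := lawX i `]-oo, 0[%classic (measurable_itv _).
  have -> : X @^-1` `]-oo, 0[ = set0.
    by apply/seteqP; split=> w //=; rewrite in_itv/= ltNge X0.
  by rewrite measure0.
have mneg i : measurable [set w | Xs i w < 0].
  have := mXs i measurableT _ (measurable_itv `]-oo, 0[); rewrite setTI.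
  by congr measurable; apply/seteqP; split=> w /=; rewrite in_itv/=.
(* Off this null event the sums over [Xs] and over [Z] coincide, so the moment bounds carry over. *)
pose bad := \bigcup_i [set w | Xs i w < 0].
have mbad : measurable bad by exact: bigcup_measurable.
have bad0 : P bad = 0%E.
  apply: measure_negligible => //; apply: negligible_bigcup => i.
  by apply/negligibleP; [exact: mneg|exact: neg0].
have good w : ~ bad w -> random_sum Xs N w = random_sum Z N w.
  move=> nb; apply: eq_bigr => i _; rewrite /Z ger0_norm// leNgt; apply/negP => Xi.
  by apply: nb; exists (val i).
apply: (determined_of_moment_growth P _ (1 + CN) (a * expR 3 * (expR 2 + bN))) => //.
- apply: (subset_measure0 (B := bad)) => //.
    have := mS measurableT _ (measurable_itv `]-oo, 0[); rewrite setTI.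
    by congr measurable; apply/seteqP; split=> w /=; rewrite in_itv/=.
  move=> w /= Sw; apply: contrapT => /good E; move: Sw; rewrite E ltNge.
  by rewrite sumr_ge0// => i _; exact: normr_ge0.
- by rewrite addr_ge0.
- by rewrite mulr_gt0 ?addr_gt0 ?expR_gt0// mulr_gt0 ?expR_gt0.
move=> k; apply: le_trans (growth k); rewrite unlock le_eqVlt; apply/orP; left; apply/eqP.
apply: ae_eq_integral => //.
- by apply/measurable_EFinP; exact: measurable_funX.
- by apply/measurable_EFinP; exact: measurable_funX.
exists bad; split=> // w /= nw; apply: contrapT => /good E; apply: nw => _.
by rewrite E.
Unshelve. all: by end_near. Qed.
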